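(* Consider the Rescaled Pólya urn with $k\ge2$ colors and parameters $\alpha>0$ and $\beta\in(0,1)$. Let $$\gamma=\beta+(1-\beta)\frac{\alpha}{(1-\beta)|\boldsymbol{b}_0|+\alpha},\qquad \lambda=\frac{(1-\beta)^2}{(\gamma-\beta)^2+(1-\gamma^2)}\Big(1+2\frac{\gamma}{1-\gamma}\Big).$$ Then, as $N\to\infty$, $\overline{\boldsymbol{\xi}}_N\to\boldsymbol{p}_0$ almost surely and $$\sqrt{N}\,(\overline{\boldsymbol{\xi}}_N-\boldsymbol{p}_0)=\frac{\sum_{n=1}^N(\boldsymbol{\xi}_n-\boldsymbol{p}_0)}{\sqrt N}\ \xrightarrow{\ d\ }\ \mathcal{N}(\boldsymbol{0},\Sigma^2),\qquad \Sigma^2=\lambda\big(\mathrm{diag}(\boldsymbol{p}_0)-\boldsymbol{p}_0\boldsymbol{p}_0^\top\big).$$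
   Context: For $x\in\mathbb{R}^k$, $|x|=\sum_{i=1}^k|x_i|$; $e_1,\dots,e_k$ is the canonical basis of $\mathbb{R}^k$. Rescaled Pólya (RP) urn with $k$ colors and parameters $\alpha,\beta$: let $\boldsymbol{b}_0=(b_{0,1},\dots,b_{0,k})^\top$ and $\boldsymbol{B}_0=(B_{0,1},\dots,B_{0,k})^\top$ be deterministic vectors with nonnegative real entries such that $|\boldsymbol{b}_0|>0$ and $b_{0,i}+B_{0,i}>0$ for every $i$. The draws $\boldsymbol{\xi}_n=(\xi_{n,1},\dots,\xi_{n,k})^\top$, $n\ge1$, are random vectors with values in $\{e_1,\dots,e_k\}$. Set $\boldsymbol{B}_{n}=\beta\boldsymbol{B}_{n-1}+\alpha\boldsymbol{\xi}_{n}$ for $n\ge1$, and $\boldsymbol{N}_n=\boldsymbol{b}_0+\boldsymbol{B}_n$ for $n\ge0$. With $\mathcal{F}_0$ trivial and $\mathcal{F}_n=\sigma(\boldsymbol{\xi}_1,\dots,\boldsymbol{\xi}_n)$, the law of the draws is determined by $$P(\xi_{n+1,i}=1\mid\mathcal{F}_n)=\psi_{n,i},\qquad \boldsymbol{\psi}_n=\frac{\boldsymbol{N}_n}{|\boldsymbol{N}_n|}=\frac{\boldsymbol{b}_0+\boldsymbol{B}_n}{|\boldsymbol{b}_0|+|\boldsymbol{B}_n|},\qquad n\ge0.$$ Set $\boldsymbol{p}_0=\boldsymbol{b}_0/|\boldsymbol{b}_0|$ and $\overline{\boldsymbol{\xi}}_N=\frac1N\sum_{n=1}^N\boldsymbol{\xi}_n$.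 $\xrightarrow{d}$ is convergence in distribution; Gaussian laws may be degenerate. *)

(* Defs.v *)
From HB Require Import structures.
From mathcomp Require Import all_boot all_order all_algebra.
From mathcomp Require Import all_classical all_reals all_analysis.

Set Implicit Arguments.
Unset Strict Implicit.
Unset Printing Implicit Defensive.

Import Order.TTheory GRing.Theory Num.Theory.
Import numFieldNormedType.Exports.

Local Open Scope classical_set_scope.
Local Open Scope ring_scope.

Notation borel_cV R k := (g_sigma_algebraType (@open 'cV[R]_k)).

Section Probability.
Context {R : realType}.

(* [Y] is a version of the conditional probability P(E | G), for a
   sigma-algebra [G] given as a set of events. *)
Definition is_cond_prob {d : measure_display} {Omega : measurableType d}
    (P : probability Omega R) (G : set (set Omega)) (E : set Omega)
    (Y : Omega -> R) : Prop :=
  [/\ forall C : set R, measurable C -> G (Y @^-1` C),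
      P.-integrable setT (EFin \o Y) &
      forall A : set Omega, G A ->
        P (E `&` A) = (\int[P]_(w in A) (Y w)%:E)%E].

(* Real normal law of mean [m] and variance [v >= 0].  The second parameter of
   [normal_prob] is the standard deviation, and [normal_prob m 0] is not the
   Dirac mass at [m] (it is the uniform law on [0, 1]), so v = 0 is separate. *)
Definition normal_law (m v : R) (A : set R) : \bar R :=
  if v == 0 then \d_m A else normal_prob m (Num.sqrt v) A.

(* [mu] = N(m, S), possibly degenerate: every linear form u^T x has the normal
   law of mean u^T m and variance u^T S u under [mu]. *)
Definition is_gaussian {k : nat} (m : 'cV[R]_k) (S : 'M[R]_k)
    (mu : probability (borel_cV R k) R) : Prop :=
  forall (u : 'cV[R]_k) (A : set R), measurable A ->
    mu [set x : 'cV[R]_k | A ((u^T *m x) 0 0)] =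
    normal_law ((u^T *m m) 0 0) ((u^T *m S *m u) 0 0) A.

Definition cvg_in_distribution {d : measure_display} {Omega : measurableType d}
    (P : probability Omega R) {k : nat} (X : nat -> Omega -> 'cV[R]_k)
    (mu : probability (borel_cV R k) R) : Prop :=
  forall f : 'cV[R]_k -> R, continuous f ->
    (exists M : R, forall x, `|f x| <= M) ->
    (\int[P]_w (f (X N w))%:E)%E @[N --> \oo] -->
    (\int[mu]_x (f x)%:E)%E.

End Probability.

Section RescaledPolya.
Context {R : realType} {k : nat}.
Implicit Types (alpha beta : R).

Definition l1norm (x : 'cV[R]_k) : R := \sum_(i < k) `|x i 0|.

Definition urn_p0 (b0 : 'cV[R]_k) : 'cV[R]_k := (l1norm b0)^-1 *: b0.

Definition urn_gamma alpha beta (b0 : 'cV[R]_k) : R :=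
  beta + (1 - beta) * (alpha / ((1 - beta) * l1norm b0 + alpha)).

Definition urn_lambda alpha beta (b0 : 'cV[R]_k) : R :=
  let gamma := urn_gamma alpha beta b0 in
  (1 - beta) ^+ 2 / ((gamma - beta) ^+ 2 + (1 - gamma ^+ 2)) *
  (1 + 2 * (gamma / (1 - gamma))).

Definition urn_Sigma2 alpha beta (b0 : 'cV[R]_k) : 'M[R]_k :=
  let p0 := urn_p0 b0 in
  urn_lambda alpha beta b0 *: (diag_mx p0^T - p0 *m p0^T).

Context {d : measure_display} {Omega : measurableType d}.
(* The draws are [xi 1], [xi 2], ...; the value [xi 0] is never used. *)
Implicit Types (xi : nat -> Omega -> 'cV[R]_k).

Fixpoint urn_B alpha beta (B0 : 'cV[R]_k) xi (n : nat) (w : Omega)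
    : 'cV[R]_k :=
  if n is m.+1 then beta *: urn_B alpha beta B0 xi m w + alpha *: xi n w
  else B0.

Definition urn_N alpha beta (b0 B0 : 'cV[R]_k) xi (n : nat) (w : Omega)
    : 'cV[R]_k :=
  b0 + urn_B alpha beta B0 xi n w.

Definition urn_psi alpha beta (b0 B0 : 'cV[R]_k) xi (n : nat) (w : Omega)
    : 'cV[R]_k :=
  (l1norm (urn_N alpha beta b0 B0 xi n w))^-1 *: urn_N alpha beta b0 B0 xi n w.

Definition urn_filtration xi (n : nat) : set (set Omega) :=
  <<s \bigcup_(m in [set m | (1 <= m <= n)%N])
        preimage_set_system setT (xi m : Omega -> borel_cV R k) measurable >>.

Record rescaled_polya_urn (P : probability Omega R) alpha beta
    (b0 B0 : 'cV[R]_k) xi : Prop := RescaledPolyaUrn {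
  urn_b0_ge0 : forall i, 0 <= b0 i 0 ;
  urn_B0_ge0 : forall i, 0 <= B0 i 0 ;
  urn_b0_gt0 : 0 < l1norm b0 ;
  urn_init_gt0 : forall i, 0 < b0 i 0 + B0 i 0 ;
  urn_draw_measurable : forall n, (1 <= n)%N ->
    measurable_fun setT (xi n : Omega -> borel_cV R k) ;
  urn_draw_basis : forall n w, (1 <= n)%N ->
    exists i : 'I_k, xi n w = delta_mx i 0 ;
  urn_draw_law : forall n (i : 'I_k),
    is_cond_prob P (urn_filtration xi n)
      [set w | xi n.+1 w i 0 = 1]
      (fun w => urn_psi alpha beta b0 B0 xi n w i 0) }.

Definition empirical_mean xi (N : nat) (w : Omega) : 'cV[R]_k :=
  N%:R^-1 *: \sum_(1 <= n < N.+1) xi n w.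

End RescaledPolya.

(* Main.v *)
Require Import Defs.
From HB Require Import structures.
From mathcomp Require Import all_boot all_order all_algebra.
From mathcomp Require Import all_classical all_reals all_analysis.
From mathcomp Require Import measurable_realfun.
From mathcomp Require Import ring lra.

Set Implicit Arguments.
Unset Strict Implicit.
Unset Printing Implicit Defensive.

Import Order.TTheory GRing.Theory Num.Theory.
Import numFieldNormedType.Exports.

Local Open Scope classical_set_scope.
Local Open Scope ring_scope.

(** Fix a vector [u] of weights on the colours and let [v i = u_i - u^T p0], so that
    [v] is orthogonal to [b0].  The statistic [y = v^T B_n] then satisfies
    [E(y_{n+1} | F_n) = gamma_n y_n] with [gamma_n = beta + alpha / (|b0| + |B_n|)],
    where [|B_n|] is deterministic and tends geometrically to [alpha / (1 - beta)];
    hence [gamma_n] tends geometrically to [gamma].  Adding a suitable multiple of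
    [y_n] to the walk [W_n = sum_{m <= n} v(colour of draw m)] gives [M_n], which
    differs from [W_n] by a bounded amount and is a martingale up to summable errors.
    Everything is therefore about [M_n].

    Law of large numbers.  The increments of [M_n] are bounded and nearly centred, so
    [E M_n^4 = O(n^2)] ([walk_moments]).  Then [sum_n E (W_n / n)^4] is finite, and
    [W_n / n] tends to 0 almost surely ([walk_lln]).

    Central limit theorem.  The conditional variance of the increments of [M_n] does
    not converge: it is an affine function of [z_n = sum_i (v_i^2 - V) B_{n,i}], where
    [V] is the variance of [v] under [p0], and of [y_n^2].  But the conditional
    expectations of [z_{n+1}] and [y_{n+1}^2] are again affine in [z_n] and [y_n^2], up
    to geometrically small errors, so that a Poisson equation can be solved by hand:
    some combination [g_n] of [z_n] and [y_n^2], the corrector, makes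
    [E((M_{n+1} - M_n)^2 + g_{n+1} | F_n) - g_n] equal to a constant [sigma^2] up to
    such errors ([mean_mart_step_sqr]).  This constant is [lambda V] ([lim_varE]).
    Consequently, with [t = 1 / sqrt N], the numbers
    [E(cos(t M_n + th) (1 - t^2 g_n / 2))] are multiplied by [exp(- t^2 sigma^2 / 2)] at
    each step, up to [O(t^3)] and geometrically small terms ([cf_step]); after [N] steps
    they are close to [exp(- sigma^2 / 2) cos th] ([cf_limit]).

    All the expectations in these arguments are finite sums over sequences of colours,
    because the draws take finitely many values: [path_mean] is such a sum and
    [integral_draws] identifies it with the integral over the sample space.

    It remains to pass from characteristic functions to convergence in distribution
    ([levy_continuity]) and to construct the limit ([gaussian_exists]).  For the first
    point, a bounded continuous function is approximated on a box by a Bernstein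
    polynomial in the variables [sin(x_i / (2 L))]; as the Bernstein operator is
    positive, the approximation keeps the bound of the function outside the box, where
    tightness makes the error small.  For the second, the covariance matrix has the
    explicit square root [sqrt lambda (diag(sqrt p0) - p0 sqrt(p0)^T)], through which
    independent standard normal variables are mapped.  The laws of the linear forms are
    identified by their characteristic functions, and uniqueness of the law with a given
    characteristic function is the continuity theorem for a constant sequence. *)

(** * Two elementary limits *)

Lemma cvg0_le (R : realType) (f g : nat -> R) : (forall n, (0 < n)%N -> `|f n| <= g n) ->
  g n @[n --> \oo] --> 0 -> f n @[n --> \oo] --> 0.
Proof.
move=> fg /cvgr0Pnorm_le g0; apply/cvgr0Pnorm_le => e e0.
have [N _ Ng] := g0 e e0; exists N.+1 => // n /= Nn.
rewrite (le_trans (fg n _))//; first exact: leq_trans Nn.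
by rewrite (le_trans (ler_norm _))// Ng //= ltnW.
Qed.

Lemma cvg_invsqrt (R : realType) :
  (Num.sqrt n%:R)^-1 @[n --> \oo] --> (0 : R).
Proof.
rewrite -cvg_shiftS /=.
have -> : (fun n => (Num.sqrt n.+1%:R)^-1) = (fun n => Num.sqrt (harmonic n)) :> (nat -> R).
  by apply/funext => n; rewrite /harmonic /= sqrtrV// ler0n.
have := cvg_comp _ _ (@cvg_harmonic R) (@sqrt_continuous R 0).
by rewrite sqrtr0.
Qed.

(** * Borel sets of column vectors *)

Section borel_vectors.
Context {R : realType}.

(** An open set is the union of the countably many rational boxes that it contains,
    so measurability of the coordinates suffices. *)
Lemma measurable_cV d (T : measurableType d) k (X : T -> 'cV[R]_k) :
  (forall i, measurable_fun setT (fun t => X t i 0)) ->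
  measurable_fun setT (X : T -> borel_cV R k).
Proof.
move=> mX; apply: (@measurability _ _ T (borel_cV R k) setT _ (@open 'cV[R]_k)) => //.
move=> _ [U oU <-]; rewrite setTI.
pose box (p : 'cV[rat]_k * rat) : set 'cV[R]_k :=
  [set x | forall i, `|x i 0 - ratr (p.1 i 0)| < ratr p.2].
have -> : X @^-1` U = \bigcup_p [set t | box p `<=` U /\ box p (X t)].
  apply/seteqP; split=> t /=; last by move=> [p _ [pU]]; exact: pU.
  move=> Ut; have : nbhs (X t) U by apply: open_nbhs_nbhs.
  move=> /nbhs_ballP[e /= e0 eU].
  have [r] : exists r : rat, ratr r \in `]0, (e / 2)[.
    by apply: rat_in_itvoo; rewrite divr_gt0.
  rewrite in_itv /= => /andP[r0 re].
  have /choice[q qP] : forall i : 'I_k, exists q : rat,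
      `|X t i 0 - ratr q| < ratr r.
    move=> i; have [q] : exists q : rat, ratr q \in `](X t i 0 - ratr r), (X t i 0 + ratr r)[.
      by apply: rat_in_itvoo; rewrite ltrBlDr -addrA ltrDl addr_gt0.
    rewrite in_itv /= => h; exists q; rewrite ltr_norml; lra.
  exists (\col_i q i, r) => //; split; last by move=> i /=; rewrite mxE.
  move=> y /= yb; apply: eU; split=> // i j; rewrite ord1.
  have := yb i; have := qP i; rewrite mxE !ltr_norml /ball /= ltr_norml; lra.
apply: countable_bigcupT_measurable; first exact: countableP.
move=> p; have [pU|npU] := pselect (box p `<=` U); last first.
  by rewrite (_ : mkset _ = set0)//; apply/seteqP; split => // t [].
rewrite (_ : mkset _ = \bigcap_(i in [set: 'I_k])
    [set t | `|X t i 0 - ratr (p.1 i 0)| < ratr p.2]); last first.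
  by apply/seteqP; split=> t /= => [[_ h] i _|h]; [exact: h|split => // i; exact: h].
apply: fin_bigcap_measurable => // i _.
have := @measurable_fun_ltr _ T R setT (fun t => `|X t i 0 - ratr (p.1 i 0)|)
   (cst (ratr p.2)).
move=> /(_ _ _ measurableT [set true]); rewrite setTI => h.
rewrite (_ : mkset _ = (fun t => `|X t i 0 - ratr (p.1 i 0)| < ratr p.2) @^-1` [set true]).
  apply: h => //; apply: measurableT_comp => //; exact: measurable_funB.
by apply/seteqP; split.
Qed.

Lemma continuous_measurable_cV k (f : 'cV[R]_k -> R) : continuous f ->
  measurable_fun setT (f : borel_cV R k -> R).
Proof.
move=> /continuousP cf.
apply: (measurability _ (RGenOpens.measurableE R)).
move=> _ [_ [a [b ->] <-]]; rewrite setTI; apply: sub_sigma_algebra.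
by apply: cf; exact: interval_open.
Qed.

Lemma measurable_coord k (i : 'I_k) :
  measurable_fun setT (fun x : borel_cV R k => (x : 'cV[R]_k) i 0).
Proof. by apply: continuous_measurable_cV; exact: coord_continuous. Qed.

Definition dot k (u x : 'cV[R]_k) : R := \sum_(i < k) u i 0 * x i 0.

Lemma dotE k (u x : 'cV[R]_k) : (u^T *m x) 0 0 = dot u x.
Proof. by rewrite mxE; apply: eq_bigr => i _; rewrite mxE. Qed.

Lemma continuous_dot k (u : 'cV[R]_k) : continuous (dot u).
Proof.
apply: (@continuous_big R 'I_k +%R 0 xpredT (@add_continuous R)) => i _ x.
apply: continuousM; [exact: cst_continuous|exact: coord_continuous].
Qed.

Lemma measurable_dot k (u : 'cV[R]_k) :
  measurable_fun setT (dot u : borel_cV R k -> R).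
Proof. by apply: continuous_measurable_cV; exact: continuous_dot. Qed.

End borel_vectors.

(** * Taylor estimates *)

Section taylor.
Context {R : realType}.

(** By the mean value theorem.  The constant 1 instead of [1 / (n + 1)] is enough
    here, and it lets the bounds be chained from [|cos| <= 1] upwards. *)
Lemma primitive_bound (F f : R -> R) (n : nat) : F 0 = 0 ->
  (forall x : R, is_derive x (1 : R) F (f x)) -> (forall x, `|f x| <= `|x| ^+ n) ->
  forall x, `|F x| <= `|x| ^+ n.+1.
Proof.
move=> F0 dF fn x.
have cF (a b : R) : {within `[a, b], continuous F}.
  apply: continuous_subspaceT => z.
  by apply/differentiable_continuous/derivable1_diffP; apply: ex_derive.
have [x0|x0] := leP 0 x.
  have [c /[!in_itv]/= /andP[c0 cx]] := MVT_segment x0 (fun z _ => dF z) (cF 0 x).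
  rewrite F0 !subr0 => ->; rewrite normrM exprS mulrC ler_wpM2l// (le_trans (fn _))//.
  by rewrite lerXn2r ?nnegrE// ger0_norm// ger0_norm// (le_trans c0).
have [c /[!in_itv]/= /andP[c0 cx]] := MVT_segment (ltW x0) (fun z _ => dF z) (cF x 0).
rewrite F0 !sub0r => e; rewrite -normrN e normrM normrN exprS mulrC.
rewrite ler_wpM2l// (le_trans (fn _))// lerXn2r ?nnegrE//.
by rewrite !ler0_norm ?lerN2// ltW.
Qed.

Lemma sin_le_norm (x : R) : `|sin x| <= `|x|.
Proof.
rewrite -[leRHS]expr1; apply: (@primitive_bound sin cos 0) => [|z]; first exact: sin0.
by rewrite expr0 cos_max.
Qed.

Lemma cos_sub1_bound (x : R) : `|1 - cos x| <= `|x| ^+ 2.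
Proof.
apply: (@primitive_bound (fun x => 1 - cos x) sin); first by rewrite cos0 subrr.
  by move=> z; apply: trigger_derive; rewrite /GRing.scale /=; ring.
by move=> z; rewrite expr1 sin_le_norm.
Qed.

Lemma cos_sub1_bound1 (x : R) : `|1 - cos x| <= 2 * `|x|.
Proof.
have [x1|x1] := leP `|x| 1.
  apply: (le_trans (cos_sub1_bound x)); rewrite expr2.
  by apply: ler_wpM2r => //; rewrite (le_trans x1)// ler1n.
apply: (@le_trans _ _ 2); last by rewrite ler_peMr// ltW.
rewrite (le_trans (ler_normB _ _))// normr1.
by have := cos_max x; lra.
Qed.

Lemma sin_taylor (x : R) : `|sin x - x| <= `|x| ^+ 3.
Proof.
apply: (@primitive_bound (fun x => sin x - x) (fun x => cos x - 1)).
- by rewrite sin0 subrr.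
- by move=> z; rewrite distrC cos_sub1_bound.
Qed.

Lemma cos_taylor4 (x : R) : `|cos x - 1 + x ^+ 2 / 2| <= `|x| ^+ 4.
Proof.
apply: (@primitive_bound (fun x => cos x - 1 + x ^+ 2 / 2) (fun x => - (sin x - x))).
- by rewrite cos0 expr0n /= mul0r addr0 subrr.
- by move=> z; apply: trigger_derive; rewrite /GRing.scale /=; field.
- by move=> z; rewrite normrN sin_taylor.
Qed.

(** A cubic bound valid on the whole line: it follows from the quartic one when
    [|x| <= 1] and from boundedness otherwise. *)
Lemma cos_taylor (x : R) : `|cos x - 1 + x ^+ 2 / 2| <= 3 * `|x| ^+ 3.
Proof.
have x0 : 0 <= `|x| by [].
have [x1|x1] := leP `|x| 1.
  apply: (le_trans (cos_taylor4 x)); rewrite exprS; apply: ler_wpM2r.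
    exact: exprn_ge0.
  by rewrite (le_trans x1)// ler1n.
have -> : x ^+ 2 = `|x| ^+ 2 by rewrite real_normK ?num_real.
have := cos_max x; rewrite ler_norml => /andP[h1 h2].
rewrite ler_norml; move: x1 x0; set y := `|x| => y1 y0.
have h3 : 1 < y ^+ 2 by rewrite exprn_egt1.
have h4 : y ^+ 2 <= y ^+ 3 by rewrite [leRHS]exprS ler_peMl ?sqr_ge0// ltW.
lra.
Qed.

Lemma cosD_taylor (a h : R) :
  `|cos (a + h) - (cos a - h * sin a - h ^+ 2 / 2 * cos a)| <= 4 * `|h| ^+ 3.
Proof.
rewrite cosD (_ : _ - _ = cos a * (cos h - 1 + h ^+ 2 / 2) - sin a * (sin h - h));
  last by field.
rewrite (le_trans (ler_normB _ _))// !normrM.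
have := cos_taylor h; have := sin_taylor h; have := cos_max a; have := sin_max a.
have := normr_ge0 (cos a); have := normr_ge0 (sin a).
set A := `|sin h - h|; set B := `|cos h - _ + _|; set y := _ ^+ 3.
have A0 : 0 <= A by exact: normr_ge0.
have B0 : 0 <= B by exact: normr_ge0.
nra.
Qed.

Lemma cosD_lip (a h : R) : `|cos (a + h) - cos a| <= 3 * `|h|.
Proof.
rewrite cosD (_ : _ - _ = - (cos a * (1 - cos h)) - sin a * sin h); last by ring.
rewrite (le_trans (ler_normB _ _))// normrN !normrM.
have := cos_sub1_bound1 h; have := sin_le_norm h; have := cos_max a; have := sin_max a.
have := normr_ge0 (cos a); have := normr_ge0 (sin a).
set A := `|sin h|; set B := `|1 - _|; set y := `|h|.
have A0 : 0 <= A by exact: normr_ge0.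
have B0 : 0 <= B by exact: normr_ge0.
nra.
Qed.

Lemma expRN_taylor (x : R) : 0 <= x -> `|expR (- x) - (1 - x)| <= x ^+ 2.
Proof.
move=> x0; rewrite ger0_norm; last by rewrite subr_ge0 expR_ge1Dx.
have : expR (- x) <= (1 + x)^-1.
  rewrite expRN lef_pV2 ?posrE ?expR_gt0//; last by rewrite ltr_wpDr.
  exact: expR_ge1Dx.
have h : (1 + x)^-1 <= 1 - x + x ^+ 2.
  by rewrite -[leLHS]mul1r ler_pdivrMr ?ltr_wpDr//; nra.
lra.
Qed.

(** One step of a nearly centred random walk with increments [delta i] and corrector
    values [g' i].  Expanding the cosine to second order in [t], the linear term is
    controlled by the drift hypothesis; in the quadratic term the random conditional
    variance only enters through its sum with the expected increment of the corrector,
    which by hypothesis is almost [s2]. *)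
Lemma cf_step (I : finType) (p delta g' : I -> R) (D G s2 eps g a t : R) :
  (forall i, 0 <= p i) -> \sum_i p i = 1 ->
  (forall i, `|delta i| <= D) -> (forall i, `|g' i| <= G) -> `|g| <= G ->
  0 <= s2 -> 0 <= t <= 1 ->
  `|\sum_i p i * delta i| <= eps ->
  `|\sum_i p i * (delta i ^+ 2 + g' i) - s2 - g| <= eps ->
  `|\sum_i p i * (cos (a + t * delta i) * (1 - t ^+ 2 / 2 * g' i)) -
     expR (- (t ^+ 2 * s2 / 2)) * (cos a * (1 - t ^+ 2 / 2 * g))|
  <= (4 * D ^+ 3 + 2 * D * G + s2 ^+ 2 * (1 + G) + s2 * G) * t ^+ 3 + 2 * t * eps.
Proof.
move=> p0 p1 hD hG hg s20 /andP[t0 t1] e1 e2.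
have D0 : 0 <= D.
  have [i _|I0] := pickP I; first exact: le_trans (hD i).
  by move: p1; rewrite big_pred0// => /eqP; rewrite eq_sym oner_eq0.
have G0 : 0 <= G by exact: le_trans hg.
have sumC (c : R) : c = \sum_i p i * c by rewrite -mulr_suml p1 mul1r.
have eps0 : 0 <= eps by exact: le_trans e1.
set M1 := \sum_i p i * delta i in e1; set M2 := \sum_i p i * (_ + _) in e2.
set S := \sum_i _.
(* [L] is the second order expansion; [K] is [L] with [M1], [M2] at their targets. *)
pose L := cos a - t * sin a * M1 - t ^+ 2 / 2 * cos a * M2.
have SL : `|S - L| <= (4 * D ^+ 3 + 2 * D * G) * t ^+ 3.
  have -> : S - L = \sum_i p i * (cos (a + t * delta i) * (1 - t ^+ 2 / 2 * g' i)
      - (cos a - t * sin a * delta i - t ^+ 2 / 2 * cos a * (delta i ^+ 2 + g' i))).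
    rewrite /L /S /M1 /M2 [X in X - _ - _](sumC (cos a)) !mulr_sumr.
    rewrite -!sumrB; apply: eq_bigr => i _; ring.
  rewrite (le_trans (ler_norm_sum _ _ _))//.
  rewrite [leRHS]sumC ler_sum// => i _.
  rewrite normrM (ger0_norm (p0 i)) ler_wpM2l//.
  have th : `|t * delta i| <= t * D by rewrite normrM ger0_norm// ler_wpM2l.
  have h1 : `|cos (a + t * delta i) - (cos a - t * delta i * sin a -
      (t * delta i) ^+ 2 / 2 * cos a)| <= 4 * (t * D) ^+ 3.
    apply: le_trans (cosD_taylor _ _) _.
    by rewrite ler_wpM2l// lerXn2r ?nnegrE// mulr_ge0.
  have h2 : `|cos (a + t * delta i) - cos a| <= 3 * (t * D).
    by apply: le_trans (cosD_lip _ _) _; rewrite ler_wpM2l.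
  rewrite (_ : _ - _ = (cos (a + t * delta i) - (cos a - t * delta i * sin a -
      (t * delta i) ^+ 2 / 2 * cos a)) -
      t ^+ 2 / 2 * (g' i * (cos (a + t * delta i) - cos a))); last by field.
  rewrite (le_trans (ler_normB _ _))//.
  have t2 : 0 <= t ^+ 2 / 2 by rewrite divr_ge0// sqr_ge0.
  have h3 : `|t ^+ 2 / 2 * (g' i * (cos (a + t * delta i) - cos a))| <=
      t ^+ 2 / 2 * (G * (3 * (t * D))).
    by rewrite normrM (ger0_norm t2) ler_wpM2l// normrM ler_pM.
  apply: le_trans (lerD h1 h3) _.
  rewrite (_ : (4 * D ^+ 3 + 2 * D * G) * t ^+ 3 =
    4 * (t * D) ^+ 3 + t ^+ 2 / 2 * (G * (4 * (t * D)))); last by field.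
  rewrite lerD2l ler_wpM2l// ler_wpM2l// ler_wpM2r ?mulr_ge0//.
  by rewrite ler_nat.
pose x := t ^+ 2 * s2 / 2.
pose K := cos a * (1 - x - t ^+ 2 / 2 * g).
have LK : `|L - K| <= 2 * t * eps.
  rewrite (_ : L - K = - (t * sin a * M1) - t ^+ 2 / 2 * cos a * (M2 - s2 - g)); last first.
    by rewrite /L /K /x; field.
  rewrite (le_trans (ler_normB _ _))// normrN.
  have h1 : `|t * sin a * M1| <= t * 1 * eps.
    by rewrite !normrM (ger0_norm t0) ler_pM ?mulr_ge0// ler_wpM2l// sin_max.
  have h2 : `|t ^+ 2 / 2 * cos a * (M2 - s2 - g)| <= t * 1 * eps.
    have t2 : 0 <= t ^+ 2 / 2 by rewrite divr_ge0// sqr_ge0.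
    rewrite normrM normrM (ger0_norm t2) ler_pM ?mulr_ge0//.
    rewrite ler_pM ?cos_max//; nra.
  by apply: le_trans (lerD h1 h2) _; lra.
have x0 : 0 <= x by rewrite /x divr_ge0// mulr_ge0// sqr_ge0.
have KE : `|K - expR (- x) * (cos a * (1 - t ^+ 2 / 2 * g))| <=
    (s2 ^+ 2 * (1 + G) + s2 * G) * t ^+ 3.
  rewrite (_ : _ - _ = - (cos a * ((expR (- x) - (1 - x)) * (1 - t ^+ 2 / 2 * g)
     + x * (t ^+ 2 / 2 * g)))); last first.
    by rewrite /K; ring.
  rewrite normrN normrM -[leRHS]mul1r ler_pM ?cos_max//.
  have q0 : 0 <= t ^+ 2 / 2 by rewrite divr_ge0// sqr_ge0.
  have q1 : t ^+ 2 / 2 <= 1 by nra.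
  have h1 : `|1 - t ^+ 2 / 2 * g| <= 1 + G.
    rewrite (le_trans (ler_normB _ _))// normr1 lerD2l normrM (ger0_norm q0).
    by rewrite -[leRHS]mul1r ler_pM.
  have h2 : `|t ^+ 2 / 2 * g| <= t ^+ 2 * G.
    by rewrite normrM (ger0_norm q0) ler_pM//; have := sqr_ge0 t; lra.
  have x1 : x ^+ 2 <= s2 ^+ 2 * t ^+ 3.
    have : t ^+ 4 <= t ^+ 3 by rewrite [leLHS]exprS ler_piMl ?exprn_ge0.
    have -> : x ^+ 2 = s2 ^+ 2 * t ^+ 4 / 4 by rewrite /x; field.
    move=> t43; have := exprn_ge0 4 t0; have := ler_wpM2l (sqr_ge0 s2) t43.
    have := sqr_ge0 s2; move: (t ^+ 4) (t ^+ 3) (s2 ^+ 2) => u v w w0 h u0.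
    have : 0 <= w * u by rewrite mulr_ge0.
    lra.
  have x2 : x * t ^+ 2 <= s2 * t ^+ 3.
    have : t ^+ 4 <= t ^+ 3 by rewrite [leLHS]exprS ler_piMl ?exprn_ge0.
    have -> : x * t ^+ 2 = s2 * t ^+ 4 / 2 by rewrite /x; field.
    move=> t43; have := exprn_ge0 4 t0; have := ler_wpM2l s20 t43.
    move: (t ^+ 4) (t ^+ 3) => u v h u0; have : 0 <= s2 * u by rewrite mulr_ge0.
    lra.
  rewrite (le_trans (ler_normD _ _))// [leRHS]mulrDl lerD//.
    by rewrite normrM [leRHS]mulrAC ler_pM//; apply: le_trans (expRN_taylor x0) _.
  rewrite normrM (ger0_norm x0) [leRHS]mulrAC; apply: (le_trans (ler_wpM2l x0 h2)); rewrite mulrA.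
  by rewrite ler_wpM2r.
have -> : S - expR (- x) * (cos a * (1 - t ^+ 2 / 2 * g)) =
   (S - L) + (L - K) + (K - expR (- x) * (cos a * (1 - t ^+ 2 / 2 * g))) by ring.
rewrite (le_trans (ler_normD _ _))// (le_trans (lerD (ler_normD _ _) (lexx _)))//.
by apply: le_trans (lerD (lerD SL LK) KE) _; lra.
Qed.
End taylor.

(** * The urn along a sequence of draws *)

Section urn_paths.
Context {R : realType} {k : nat} (alpha beta : R) (b0 B0 : 'I_k -> R).

(** A sequence of draws is a list of colours with the latest draw first, so that the
    recursion of the urn is structural. *)
Fixpoint path_content (s : seq 'I_k) (j : 'I_k) : R :=
  if s is i :: s' then beta * path_content s' j + alpha * (j == i)%:R else B0 j.

Definition path_law (s : seq 'I_k) (j : 'I_k) : R :=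
  (b0 j + path_content s j) / \sum_i (b0 i + path_content s i).

Fixpoint path_weight (s : seq 'I_k) : R :=
  if s is i :: s' then path_weight s' * path_law s' i else 1.

Fixpoint paths (n : nat) : seq (seq 'I_k) :=
  if n is m.+1 then [seq i :: s | s <- paths m, i <- enum 'I_k] else [:: [::]].

(** The expectation of a function of the first [n] draws, as a finite sum. *)
Definition path_mean (n : nat) (h : seq 'I_k -> R) : R :=
  \sum_(s <- paths n) path_weight s * h s.

Lemma mean0 h : path_mean 0 h = h [::].
Proof. by rewrite /path_mean /= big_seq1 mul1r. Qed.

(** Conditioning on the first [n] draws. *)
Lemma meanS n h :
  path_mean n.+1 h = path_mean n (fun s => \sum_i path_law s i * h (i :: s)).
Proof.
rewrite /path_mean /= big_allpairs_dep; apply: eq_bigr => s _.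
by rewrite big_enum mulr_sumr; apply: eq_bigr => i _; rewrite /= mulrA.
Qed.

Lemma size_paths n s : s \in paths n -> size s = n.
Proof.
elim: n s => [|n ih] s /=; first by rewrite inE => /eqP->.
by move=> /allpairsP[[s' i] /= [/ih <- _ ->]].
Qed.

Lemma meanD n h1 h2 : path_mean n (fun s => h1 s + h2 s) = path_mean n h1 + path_mean n h2.
Proof. by rewrite -big_split; apply: eq_bigr => s _; rewrite mulrDr. Qed.

Lemma meanZ n a h : path_mean n (fun s => a * h s) = a * path_mean n h.
Proof. by rewrite mulr_sumr; apply: eq_bigr => s _; rewrite mulrCA. Qed.

Lemma meanB n h1 h2 : path_mean n (fun s => h1 s - h2 s) = path_mean n h1 - path_mean n h2.
Proof. by rewrite -sumrB; apply: eq_bigr => s _; rewrite mulrBr. Qed.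

Lemma eq_mean n h1 h2 : (forall s, size s = n -> h1 s = h2 s) ->
  path_mean n h1 = path_mean n h2.
Proof.
move=> h; rewrite /path_mean big_seq [RHS]big_seq.
by apply: eq_bigr => s /size_paths sn; rewrite h.
Qed.

Context (alpha_gt0 : 0 < alpha) (beta_gt0 : 0 < beta) (beta_lt1 : beta < 1).
Context (b0_ge0 : forall i, 0 <= b0 i) (B0_ge0 : forall i, 0 <= B0 i).
Context (b0_gt0 : 0 < \sum_i b0 i).

Local Notation b := (\sum_i b0 i).

Lemma path_content_ge0 s j : 0 <= path_content s j.
Proof.
elim: s => //= i s ih.
by rewrite addr_ge0// mulr_ge0// ltW.
Qed.

Fixpoint total (n : nat) : R :=
  if n is m.+1 then beta * total m + alpha else \sum_i B0 i.

Lemma sum_path_content s : \sum_i path_content s i = total (size s).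
Proof.
elim: s => //= i s ih; rewrite big_split /= -!mulr_sumr ih; congr (_ + _).
by rewrite (bigD1 i)//= eqxx big1 ?addr0 ?mulr1// => j /negbTE ->.
Qed.

Lemma total_ge0 n : 0 <= total n.
Proof.
elim: n => [|n ih] /=; first exact: sumr_ge0.
by rewrite addr_ge0 ?mulr_ge0// ltW.
Qed.

Lemma urn_size s : \sum_i (b0 i + path_content s i) = b + total (size s).
Proof. by rewrite big_split /= sum_path_content. Qed.

Definition inv_total n : R := (b + total n)^-1.

Lemma inv_total_ge0 n : 0 <= inv_total n.
Proof. by rewrite invr_ge0 addr_ge0 ?total_ge0// ltW. Qed.

Lemma path_lawE s j : path_law s j = inv_total (size s) * (b0 j + path_content s j).
Proof. by rewrite /path_law urn_size mulrC. Qed.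

Lemma path_law_ge0 s j : 0 <= path_law s j.
Proof. by rewrite path_lawE mulr_ge0 ?inv_total_ge0// addr_ge0 ?path_content_ge0. Qed.

Lemma path_law_sum1 s : \sum_j path_law s j = 1.
Proof.
rewrite -mulr_suml divff// urn_size gt_eqF// ltr_wpDr ?total_ge0//.
Qed.

Lemma path_weight_ge0 s : 0 <= path_weight s.
Proof. by elim: s => //= i s ih; rewrite mulr_ge0// path_law_ge0. Qed.

Lemma ler_mean n h1 h2 : (forall s, size s = n -> h1 s <= h2 s) ->
  path_mean n h1 <= path_mean n h2.
Proof.
move=> h; rewrite /path_mean big_seq [leRHS]big_seq; apply: ler_sum => s /size_paths sn.
by rewrite ler_wpM2l ?path_weight_ge0// h.
Qed.

Lemma mean_cst n a : path_mean n (fun=> a) = a.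
Proof.
elim: n => [|n ih]; first by rewrite mean0.
rewrite meanS (eq_mean (h2 := fun=> a))// => s _.
by rewrite -mulr_suml path_law_sum1 mul1r.
Qed.

Lemma ler_norm_mean n h : `|path_mean n h| <= path_mean n (fun s => `|h s|).
Proof.
rewrite (le_trans (ler_norm_sum _ _ _))//; apply: ler_sum => s _.
by rewrite normrM ger0_norm// path_weight_ge0.
Qed.

Definition urn_stat (a : 'I_k -> R) (s : seq 'I_k) : R := \sum_j a j * path_content s j.

Lemma stat_cons a i s : urn_stat a (i :: s) = beta * urn_stat a s + alpha * a i.
Proof.
rewrite /urn_stat /=.
under eq_bigr do rewrite mulrDr.
rewrite big_split /=; congr (_ + _).
  by rewrite mulr_sumr; apply: eq_bigr => j _; rewrite mulrCA.
rewrite (bigD1 i)//= eqxx big1 ?addr0 ?mulr1 ?(mulrC alpha)// => j /negbTE ->.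
by rewrite !mulr0.
Qed.

(** For a statistic orthogonal to [b0] the conditional mean of the next draw is
    proportional to the current value; this is what closes the moment equations. *)
Lemma path_law_stat a s : \sum_i b0 i * a i = 0 ->
  \sum_i path_law s i * a i = inv_total (size s) * urn_stat a s.
Proof.
move=> ab; under eq_bigr do rewrite path_lawE -mulrA mulrDl.
rewrite -mulr_sumr big_split /= ab add0r; congr (_ * _).
by apply: eq_bigr => j _; rewrite mulrC.
Qed.

Definition total_lim : R := alpha / (1 - beta).
Definition inv_total_lim : R := (b + total_lim)^-1.

Lemma total_lim_gt0 : 0 < total_lim.
Proof. by rewrite divr_gt0// subr_gt0. Qed.

Lemma total_sub_lim n : total n - total_lim = beta ^+ n * (total 0 - total_lim).
Proof.
elim: n => [|n ih] /=; first by rewrite expr0 mul1r.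
rewrite exprS -mulrA -ih /total_lim; field; rewrite subr_eq0 gt_eqF//.
Qed.

Lemma inv_total_lim_gt0 : 0 < inv_total_lim.
Proof. by rewrite invr_gt0 addr_gt0 ?total_lim_gt0. Qed.

Definition inv_total_gap : R := `|total 0 - total_lim| / b ^+ 2.

Lemma inv_total_gap_ge0 : 0 <= inv_total_gap.
Proof. by rewrite divr_ge0// sqr_ge0. Qed.

(** The transition law depends on time only through the total content of the urn,
    which converges geometrically; all time-inhomogeneity is thus summable. *)
Lemma inv_total_sub_lim n : `|inv_total n - inv_total_lim| <= inv_total_gap * beta ^+ n.
Proof.
have t0 := total_ge0 n; have t1 := total_lim_gt0; have bp := b0_gt0.
have -> : inv_total n - inv_total_lim = - (total n - total_lim) / ((b + total n) * (b + total_lim)).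
  rewrite /inv_total /inv_total_lim; field; rewrite !gt_eqF//; [exact: ltr_wpDr|exact: addr_gt0].
rewrite normrM normrN total_sub_lim normrM.
rewrite (ger0_norm (exprn_ge0 n (ltW beta_gt0))) mulrC (mulrC (beta ^+ n)) mulrA.
rewrite ler_wpM2r ?exprn_ge0 ?(ltW beta_gt0)// mulrC ler_wpM2l// ger0_norm; last first.
  by rewrite invr_ge0 mulr_ge0// addr_ge0// ltW.
rewrite lef_pV2 ?posrE ?mulr_gt0 ?exprn_gt0//; last 2 first.
- exact: ltr_wpDr.
- exact: addr_gt0.
by rewrite expr2 ler_pM ?(ltW bp)// lerDl// ltW.
Qed.

Definition total_max : R := total 0 + total_lim.

Lemma total_le n : total n <= total_max.
Proof.
have := total_sub_lim n; have := total_ge0 0; have := total_lim_gt0.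
have : 0 <= beta ^+ n by rewrite exprn_ge0// ltW.
have : beta ^+ n <= 1 by rewrite exprn_ile1// ltW.
rewrite /total_max; set q := beta ^+ n; set T := total n; set T0 := total 0.
set Too := total_lim => q1 q0 Too0 T00 e; nra.
Qed.

(** The hypothesis [0 < \sum_i b0 i] guarantees that there is a colour, and hence
    that [K] is nonnegative. *)
Lemma stat_bound a K s : (forall i, `|a i| <= K) -> `|urn_stat a s| <= K * total_max.
Proof.
move=> aK; rewrite (le_trans (ler_norm_sum _ _ _))//.
apply: (@le_trans _ _ (\sum_i K * path_content s i)).
  apply: ler_sum => i _; rewrite normrM (ger0_norm (path_content_ge0 _ _)).
  by rewrite ler_wpM2r// path_content_ge0.
rewrite -mulr_sumr sum_path_content.
have [i0 _|I0] := pickP 'I_k.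
  by rewrite ler_wpM2l ?total_le// (le_trans _ (aK i0)).
by move: b0_gt0; rewrite big_pred0// ltxx.
Qed.

End urn_paths.

(** * A martingale and its corrector *)

Lemma sum_sub_sqr (R : realType) (I : finType) (p x : I -> R) (a : R) :
  \sum_i p i = 1 -> \sum_i p i * (x i - a) ^+ 2 =
  \sum_i p i * x i ^+ 2 - 2 * a * (\sum_i p i * x i) + a ^+ 2.
Proof.
move=> p1; have -> : a ^+ 2 = \sum_i a ^+ 2 * p i by rewrite -mulr_sumr p1 mulr1.
rewrite !mulr_sumr -sumrB -big_split /=.
by apply: eq_bigr => i _; ring.
Qed.

Section urn_fluctuations.
Context {R : realType} {k : nat} (alpha beta : R) (b0 B0 : 'I_k -> R).
Context (alpha_gt0 : 0 < alpha) (beta_gt0 : 0 < beta) (beta_lt1 : beta < 1).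
Context (b0_ge0 : forall i, 0 <= b0 i) (B0_ge0 : forall i, 0 <= B0 i).
Context (b0_gt0 : 0 < \sum_i b0 i).
Context (v : 'I_k -> R) (v0 : \sum_i b0 i * v i = 0).

Local Notation b := (\sum_i b0 i).
Local Notation c := (inv_total_lim alpha beta b0).
Local Notation cn := (inv_total alpha beta b0 B0).
Local Notation psi := (path_law alpha beta b0 B0).
Local Notation lin := (urn_stat alpha beta B0).
Local Notation mean := (path_mean alpha beta b0 B0).

Definition color_var : R := (\sum_i b0 i * v i ^+ 2) / b.
(** The function whose statistic governs the fluctuations of the conditional second
    moment of [v]; like [v] it is orthogonal to [b0]. *)
Definition sqr_dev (i : 'I_k) : R := v i ^+ 2 - color_var.

Lemma sqr_dev0 : \sum_i b0 i * sqr_dev i = 0.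
Proof.
rewrite /sqr_dev; under eq_bigr do rewrite mulrBr.
by rewrite sumrB -mulr_suml /color_var mulrC divfK ?subrr// gt_eqF.
Qed.

Lemma color_var_ge0 : 0 <= color_var.
Proof.
by rewrite divr_ge0// ?(ltW b0_gt0)// sumr_ge0// => i _; rewrite mulr_ge0// sqr_ge0.
Qed.

Definition contraction : R := beta + alpha * c.

Lemma contraction_lt1 : contraction < 1.
Proof.
have T0 := total_lim_gt0 alpha_gt0 beta_lt1.
have b1 : 0 < 1 - beta by rewrite subr_gt0.
rewrite /contraction -ltrBrDl /inv_total_lim ltr_pdivrMr ?addr_gt0// mulrDr.
have -> : (1 - beta) * total_lim alpha beta = alpha.
  by rewrite /total_lim mulrC divfK// gt_eqF.
by rewrite ltrDr mulr_gt0.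
Qed.

Lemma contraction_gt0 : 0 < contraction.
Proof.
have c0 := inv_total_lim_gt0 alpha_gt0 beta_lt1 b0_gt0.
by rewrite addr_gt0// mulr_gt0.
Qed.

(** The factor by which the conditional mean of the square of the statistic of [v]
    multiplies that square, in the limit. *)
Definition contraction2 : R := beta ^+ 2 + 2 * beta * alpha * c.

Lemma contraction2_lt1 : contraction2 < 1.
Proof.
have -> : contraction2 = contraction ^+ 2 - (alpha * c) ^+ 2.
  by rewrite /contraction2 /contraction; ring.
have := sqr_ge0 (alpha * c); have := contraction_lt1; have := contraction_gt0.
have : contraction ^+ 2 < 1 -> contraction ^+ 2 - (alpha * c) ^+ 2 < 1.
  by have := sqr_ge0 (alpha * c); lra.
by move=> h g0 g1 _; apply: h; rewrite expr_lt1// ltW.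
Qed.

(** The statistic of [v], with the coefficient [mart_coef], turns the walk into an
    almost-martingale with increments [mart_scale * (v i - c * y)].  The coefficients
    [corr_quad] and [corr_lin] solve the triangular linear system which makes the
    conditional variance of these increments, plus the conditional increment of the
    corrector, constant. *)
Definition mart_scale : R := (1 - beta) / (1 - contraction).
Definition mart_coef : R := c / (1 - contraction).
Definition corr_quad : R := - (mart_scale ^+ 2 * c ^+ 2) / (1 - contraction2).
Definition corr_lin : R := (mart_scale ^+ 2 * c + corr_quad * alpha ^+ 2 * c) / (1 - contraction).

Definition lim_var : R := mart_scale ^+ 2 * color_var + corr_quad * alpha ^+ 2 * color_var.

Definition walk (s : seq 'I_k) : R := \sum_(i <- s) v i.
Definition mart (s : seq 'I_k) : R := walk s + mart_coef * lin v s.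
Definition mart_step s i : R := mart_scale * (v i - c * lin v s).
Definition corr (s : seq 'I_k) : R := corr_lin * lin sqr_dev s + corr_quad * lin v s ^+ 2.

(** The choice of [mart_coef] makes the increment proportional to [v i - c * y],
    whose conditional mean vanishes when the total content has its limit value. *)
Lemma mart_cons i s : mart (i :: s) = mart s + mart_step s i.
Proof.
rewrite /mart /walk big_cons stat_cons /mart_step /mart_scale /mart_coef /contraction.
have := contraction_lt1; rewrite -subr_gt0 => /lt0r_neq0; rewrite /contraction.
by move=> h; field.
Qed.

Lemma mean_mart_step s :
  \sum_i psi s i * mart_step s i = mart_scale * (cn (size s) - c) * lin v s.
Proof.
transitivity (mart_scale * (\sum_i psi s i * v i - c * lin v s * \sum_i psi s i)).
  by rewrite mulr_sumr -sumrB mulr_sumr; apply: eq_bigr => i _; rewrite /mart_step; ring.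
rewrite path_law_stat// path_law_sum1//; ring.
Qed.

Lemma mean_draw_sqr s : \sum_i psi s i * v i ^+ 2 = color_var + cn (size s) * lin sqr_dev s.
Proof.
have <- : \sum_i psi s i * sqr_dev i = cn (size s) * lin sqr_dev s.
  by rewrite path_law_stat// sqr_dev0.
rewrite /sqr_dev; under [in RHS]eq_bigr do rewrite mulrBr.
by rewrite sumrB -mulr_suml path_law_sum1// mul1r addrC subrK.
Qed.

(** With the limiting total content, the coefficients of [z] and [y ^ 2] cancel by the
    choice of [corr_lin] and [corr_quad]; as the expression is affine in the inverse
    total content, only its distance to the limit remains as a factor. *)
Lemma mean_mart_step_sqr s :
  \sum_i psi s i * (mart_step s i ^+ 2 + corr (i :: s)) - lim_var - corr s =
  (cn (size s) - c) * (mart_scale ^+ 2 * (lin sqr_dev s - 2 * c * lin v s ^+ 2) +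
     corr_lin * alpha * lin sqr_dev s +
     corr_quad * (2 * beta * alpha * lin v s ^+ 2 + alpha ^+ 2 * lin sqr_dev s)).
Proof.
set q := cn (size s); set y := lin v s; set z := lin sqr_dev s.
have p1 : \sum_i psi s i = 1 by exact: path_law_sum1.
have e1 : \sum_i psi s i * v i = q * y by rewrite path_law_stat.
have e2 : \sum_i psi s i * v i ^+ 2 = color_var + q * z by exact: mean_draw_sqr.
have e3 : \sum_i psi s i * sqr_dev i = q * z by rewrite path_law_stat// sqr_dev0.
have ec i : corr (i :: s) =
    corr_lin * (beta * z + alpha * sqr_dev i) + corr_quad * (beta * y + alpha * v i) ^+ 2.
  by rewrite /corr !stat_cons.
have ed i : mart_step s i = mart_scale * (v i - c * y) by [].
have es : corr s = corr_lin * z + corr_quad * y ^+ 2 by [].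
clearbody q y z.
have -> : \sum_i psi s i * (mart_step s i ^+ 2 + corr (i :: s)) =
    mart_scale ^+ 2 * (\sum_i psi s i * v i ^+ 2 -
      2 * (c * y) * (\sum_i psi s i * v i) + (c * y) ^+ 2)
    + corr_lin * (beta * z * (\sum_i psi s i) + alpha * \sum_i psi s i * sqr_dev i)
    + corr_quad * ((beta * y) ^+ 2 * (\sum_i psi s i) +
       2 * (beta * y) * alpha * (\sum_i psi s i * v i)
       + alpha ^+ 2 * \sum_i psi s i * v i ^+ 2).
  rewrite -sum_sub_sqr// !mulr_sumr -!big_split /= !mulr_sumr -!big_split /=.
  apply: eq_bigr => i _; rewrite ec ed; ring.
rewrite p1 e1 e2 e3.
have h1 : 1 - contraction != 0 by rewrite subr_eq0 eq_sym lt_eqF ?contraction_lt1.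
have h2 : 1 - contraction2 != 0 by rewrite subr_eq0 eq_sym lt_eqF ?contraction2_lt1.
have hA : corr_lin * (1 - contraction) =
    mart_scale ^+ 2 * c + corr_quad * alpha ^+ 2 * c by rewrite /corr_lin divfK.
have hB : corr_quad * (1 - contraction2) = - (mart_scale ^+ 2 * c ^+ 2) by rewrite /corr_quad divfK.
rewrite es /lim_var.
apply/eqP; rewrite -subr_eq0; apply/eqP.
transitivity ((mart_scale ^+ 2 * c + corr_quad * alpha ^+ 2 * c - corr_lin * (1 - contraction)) * z
   - (mart_scale ^+ 2 * c ^+ 2 + corr_quad * (1 - contraction2)) * y ^+ 2).
  by rewrite /contraction /contraction2; ring.
by rewrite hA hB; ring.
Qed.

Lemma lim_varE : lim_var =
  (1 - beta) ^+ 2 / ((contraction - beta) ^+ 2 + (1 - contraction ^+ 2)) *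
  (1 + 2 * (contraction / (1 - contraction))) * color_var.
Proof.
have h1 : 1 - contraction != 0 by rewrite subr_eq0 eq_sym lt_eqF ?contraction_lt1.
have h2 : 1 - contraction2 != 0 by rewrite subr_eq0 eq_sym lt_eqF ?contraction2_lt1.
have e2 : (contraction - beta) ^+ 2 + (1 - contraction ^+ 2) = 1 - contraction2.
  by rewrite /contraction2 /contraction; ring.
have e3 : alpha * c = contraction - beta by rewrite /contraction; ring.
have e4 : 1 - contraction ^+ 2 = 1 - contraction2 - (contraction - beta) ^+ 2 by rewrite -e2; ring.
rewrite e2 /lim_var /corr_quad.
transitivity (mart_scale ^+ 2 * color_var * (1 - (alpha * c) ^+ 2 / (1 - contraction2))).
  by ring.
rewrite e3 (_ : 1 - _ / _ = (1 - contraction ^+ 2) / (1 - contraction2)); last first.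
  by rewrite e4; field.
by rewrite /mart_scale; field; rewrite h1 h2.
Qed.

Lemma lim_var_ge0 : 0 <= lim_var.
Proof.
rewrite lim_varE.
have g0 := contraction_gt0; have g1 := contraction_lt1.
rewrite mulr_ge0 ?color_var_ge0// mulr_ge0//.
  have g0' := ltW g0; have g1' := ltW g1.
  have : contraction ^+ 2 <= 1 by rewrite expr_le1.
  by move=> h; rewrite divr_ge0 ?sqr_ge0// addr_ge0 ?sqr_ge0// subr_ge0.
by rewrite addr_ge0// mulr_ge0// divr_ge0// ?subr_ge0 ltW.
Qed.

(** The urn contents are bounded, so a single constant serves for all the estimates
    used below. *)
Lemma step_bounds : exists2 C, 0 <= C &
  forall s, [/\ forall i, `|v i| <= C, forall i, `|mart_step s i| <= C, `|corr s| <= C,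
    `|mart_coef * lin v s| <= C &
    `|\sum_i psi s i * mart_step s i| <= C * beta ^+ size s /\
    `|\sum_i psi s i * (mart_step s i ^+ 2 + corr (i :: s)) - lim_var - corr s|
       <= C * beta ^+ size s].
Proof.
pose K := \sum_i `|v i|.
have Kv i : `|v i| <= K by rewrite /K (bigD1 i)//= lerDl sumr_ge0.
have K0 : 0 <= K by rewrite sumr_ge0.
pose K2 := \sum_i `|sqr_dev i|.
have Kw i : `|sqr_dev i| <= K2 by rewrite /K2 (bigD1 i)//= lerDl sumr_ge0.
pose Y := K * total_max alpha beta B0; pose Z := K2 * total_max alpha beta B0.
have yY s : `|lin v s| <= Y by apply: (stat_bound alpha_gt0 _ _ _ b0_gt0).
have zZ s : `|lin sqr_dev s| <= Z by apply: (stat_bound alpha_gt0 _ _ _ b0_gt0).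
have Y0 : 0 <= Y by exact: le_trans (yY [::]).
have Z0 : 0 <= Z by apply: le_trans (zZ [::]).
pose C1 := `|mart_scale| * (K + `|c| * Y).
pose C2 := `|corr_lin| * Z + `|corr_quad| * Y ^+ 2.
pose C3 := `|mart_coef| * Y.
pose E := inv_total_gap alpha beta b0 B0.
pose C4 := `|mart_scale| * E * Y.
pose Q := mart_scale ^+ 2 * (Z + 2 * `|c| * Y ^+ 2) + `|corr_lin * alpha| * Z +
  `|corr_quad| * (2 * `|beta * alpha| * Y ^+ 2 + alpha ^+ 2 * Z).
pose C5 := E * Q.
have E0 : 0 <= E by exact: inv_total_gap_ge0.
have y2 s : `|lin v s ^+ 2| <= Y ^+ 2.
  by rewrite normrX lerXn2r ?nnegrE.
have C10 : 0 <= C1 by rewrite mulr_ge0// addr_ge0// mulr_ge0.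
have C20 : 0 <= C2 by rewrite addr_ge0// mulr_ge0// sqr_ge0.
have C30 : 0 <= C3 by apply: mulr_ge0.
have C40 : 0 <= C4 by apply: mulr_ge0 => //; apply: mulr_ge0.
have Q0 : 0 <= Q.
  by rewrite /Q; do ![done|exact: sqr_ge0|apply: addr_ge0|apply: mulr_ge0].
have C50 : 0 <= C5 by apply: mulr_ge0.
exists (K + C1 + C2 + C3 + C4 + C5) => [|s]; first by lra.
have le5 x : x <= C1 \/ x <= C2 \/ x <= C3 \/ x <= K ->
    x <= K + C1 + C2 + C3 + C4 + C5 by lra.
split.
- by move=> i; apply: le5; do 3 right; exact: Kv.
- move=> i; apply: le5; left; rewrite /mart_step normrM ler_wpM2l//.
  by rewrite (le_trans (ler_normB _ _))// lerD// normrM ler_wpM2l.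
- apply: le5; right; left; rewrite (le_trans (ler_normD _ _))//.
  by rewrite lerD// normrM ler_wpM2l.
- by apply: le5; right; right; left; rewrite normrM ler_wpM2l.
have bs : 0 <= beta ^+ size s by rewrite exprn_ge0// ltW.
split.
- rewrite mean_mart_step normrM normrM; apply: (@le_trans _ _ (C4 * beta ^+ size s)); last first.
    by rewrite ler_wpM2r//; lra.
  rewrite /C4 [leRHS]mulrAC ler_pM ?mulr_ge0// -[leRHS]mulrA ler_wpM2l//; exact: inv_total_sub_lim.
- rewrite mean_mart_step_sqr normrM.
  apply: (@le_trans _ _ (C5 * beta ^+ size s)); last by rewrite ler_wpM2r//; lra.
  rewrite /C5 [leRHS]mulrAC ler_pM//; first exact: inv_total_sub_lim.
  rewrite /Q (le_trans (ler_normD _ _))// lerD//.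
    rewrite (le_trans (ler_normD _ _))// lerD//.
      rewrite normrM (ger0_norm (sqr_ge0 _)) ler_wpM2l ?sqr_ge0//.
      rewrite (le_trans (ler_normB _ _))// lerD// normrM normrM.
      by rewrite (ger0_norm (ler0n _ 2)) ler_wpM2l// mulr_ge0.
    by rewrite normrM ler_wpM2l.
  rewrite normrM ler_wpM2l// (le_trans (ler_normD _ _))// lerD//.
    rewrite -[2 * beta * alpha]mulrA normrM normrM (ger0_norm (ler0n _ 2)).
    by rewrite ler_wpM2l// mulr_ge0.
  by rewrite normrM (ger0_norm (sqr_ge0 _)) ler_wpM2l ?sqr_ge0.
Qed.

Lemma mart_bound C s : (forall s i, `|mart_step s i| <= C) ->
  `|mart s| <= `|mart [::]| + (size s)%:R * C.
Proof.
move=> dC; elim: s => [|i s ih]; first by rewrite mul0r addr0.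
rewrite mart_cons (le_trans (ler_normD _ _))//= -[in leRHS]natr1 mulrDl mul1r addrA.
by rewrite lerD.
Qed.

Lemma geo_sum_le n : \sum_(j < n) beta ^+ j <= (1 - beta)^-1.
Proof.
have b1 : 0 < 1 - beta by rewrite subr_gt0.
rewrite -[leRHS]mul1r ler_pdivlMr// mulrC -opprB mulNr -subrX1 opprB.
by rewrite lerBlDr lerDl exprn_ge0// ltW.
Qed.

(** Each of the [n + 1] powers [beta ^ j] with [j <= n] is at least [beta ^ n]. *)
Lemma natr_geo_le n : n.+1%:R * beta ^+ n <= (1 - beta)^-1.
Proof.
apply: le_trans (geo_sum_le n.+1); rewrite mulr_natl -[n.+1 in leLHS]card_ord -sumr_const.
apply: ler_sum => i _; apply: ler_wiXn2l; rewrite ?(ltW beta_gt0) ?(ltW beta_lt1)//.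
by rewrite -ltnS.
Qed.

End urn_fluctuations.

(** * The characteristic function of the walk *)

Section urn_limits.
Context {R : realType} {k : nat} (alpha beta : R) (b0 B0 : 'I_k -> R).
Context (alpha_gt0 : 0 < alpha) (beta_gt0 : 0 < beta) (beta_lt1 : beta < 1).
Context (b0_ge0 : forall i, 0 <= b0 i) (B0_ge0 : forall i, 0 <= B0 i).
Context (b0_gt0 : 0 < \sum_i b0 i).
Context (v : 'I_k -> R) (v0 : \sum_i b0 i * v i = 0).

Local Notation psi := (path_law alpha beta b0 B0).
Local Notation mean := (path_mean alpha beta b0 B0).
Local Notation mart := (mart alpha beta b0 B0 v).
Local Notation corr := (corr alpha beta b0 B0 v).
Local Notation mart_step := (mart_step alpha beta b0 B0 v).
Local Notation walk := (walk v).
Local Notation sigma2 := (lim_var alpha beta b0 v).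

(** The one-step estimate is iterated [N] times with [t = 1 / sqrt N]; then the
    martingale is replaced by the walk and the corrector is dropped, both at a cost
    of order [t]. *)
Lemma cf_bound : exists K : R, forall (N : nat) (t th : R), 0 < t <= 1 -> N%:R * t ^+ 2 = 1 ->
  `|mean N (fun s => cos (t * walk s + th)) - expR (- (sigma2 / 2)) * cos th| <= K * t.
Proof.
have [C C0 HC] := step_bounds alpha_gt0 beta_gt0 beta_lt1 B0_ge0 b0_gt0 v0.
have s20 := lim_var_ge0 alpha_gt0 beta_gt0 beta_lt1 b0_ge0 b0_gt0 v.
pose K0 := 4 * C ^+ 3 + 2 * C * C + sigma2 ^+ 2 * (1 + C) + sigma2 * C.
exists (K0 + 2 * C * (1 - beta)^-1 + 8 * C) => N t th /andP[t0 t1] Nt.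
have t0' := ltW t0.
have t2t : t ^+ 2 <= t by rewrite expr2 ler_piMl.
pose F s := cos (t * mart s + th) * (1 - t ^+ 2 / 2 * corr s).
pose r := expR (- (t ^+ 2 * sigma2 / 2)).
have r0 : 0 <= r by exact: expR_ge0.
have r1 : r <= 1 by rewrite -expR0 ler_expR oppr_le0 divr_ge0// mulr_ge0// sqr_ge0.
have step n : `|mean n.+1 F - r * mean n F| <= K0 * t ^+ 3 + 2 * t * (C * beta ^+ n).
  rewrite meanS -meanZ -meanB.
  apply: (le_trans (ler_norm_mean alpha_gt0 beta_gt0 b0_ge0 B0_ge0 b0_gt0 _ _)).
  rewrite -[leRHS](mean_cst alpha_gt0 beta_gt0 B0_ge0 b0_gt0 n).
  apply: ler_mean => // s sn.
  have [h1 h2 h3 h4 [h5 h6]] := HC s.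
  have := @cf_step R 'I_k (psi s) (mart_step s) (fun i => corr (i :: s)) C C sigma2
    (C * beta ^+ size s) (corr s) (t * mart s + th) t.
  rewrite sn => /(_ _ _ h2 _ h3 s20 _ _ _) h; apply: le_trans (h _ _ _ _ _ _).
  - rewrite /F le_eqVlt; apply/orP; left; apply/eqP; congr (`| _ - _ |).
    apply: eq_bigr => i _; rewrite mart_cons//; congr (_ * (cos _ * _)); ring.
  - by move=> i; apply: path_law_ge0.
  - exact: path_law_sum1.
  - by move=> i; have [_ _] := HC (i :: s).
  - by rewrite t0' t1.
  - by rewrite -sn.
  - by rewrite -sn.
have iter n : `|mean n F - r ^+ n * mean 0 F| <=
    n%:R * (K0 * t ^+ 3) + 2 * t * C * \sum_(j < n) beta ^+ j.
  elim: n => [|n ih].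
    by rewrite big_ord0 expr0 mul1r subrr normr0 mul0r mulr0 addr0.
  rewrite (_ : _ - _ = (mean n.+1 F - r * mean n F) +
    r * (mean n F - r ^+ n * mean 0 F)); last by rewrite exprS; ring.
  rewrite (le_trans (ler_normD _ _))// -[n.+1%:R]natr1.
  have -> : \sum_(j < n.+1) beta ^+ j = \sum_(j < n) beta ^+ j + beta ^+ n.
    by rewrite big_ord_recr.
  have ih' : `|r * (mean n F - r ^+ n * mean 0 F)| <=
      n%:R * (K0 * t ^+ 3) + 2 * t * C * \sum_(j < n) beta ^+ j.
    by rewrite normrM (ger0_norm r0); apply: le_trans ih; rewrite ler_piMl.
  by apply: le_trans (lerD (step n) ih') _; rewrite le_eqVlt; apply/orP; left; apply/eqP; ring.
have rN : r ^+ N = expR (- (sigma2 / 2)).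
  rewrite /r -expRM_natl; congr expR; transitivity (- (N%:R * t ^+ 2 * sigma2 / 2)); first by ring.
  by rewrite Nt mul1r.
have e1 : `|mean N F - r ^+ N * mean 0 F| <= K0 * t + 2 * t * C * (1 - beta)^-1.
  apply: (le_trans (iter N)); apply: lerD.
    have -> : N%:R * (K0 * t ^+ 3) = N%:R * t ^+ 2 * (K0 * t) by ring.
    by rewrite Nt mul1r.
  by rewrite ler_wpM2l ?mulr_ge0//; exact: geo_sum_le.
have e2 s : `|F s - cos (t * walk s + th)| <= 4 * C * t.
  have [_ _ h3 h4 _] := HC s.
  rewrite (_ : _ - _ = (cos (t * mart s + th) - cos (t * walk s + th))
     - t ^+ 2 / 2 * (corr s * cos (t * mart s + th))); last by rewrite /F; ring.
  rewrite (le_trans (ler_normB _ _))//.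
  have -> : t * mart s + th = (t * walk s + th) + t * (mart s - walk s) by ring.
  have h5 : `|mart s - walk s| <= C by rewrite /mart addrAC subrr add0r.
  have h6 := cosD_lip (t * walk s + th) (t * (mart s - walk s)).
  rewrite normrM (ger0_norm t0') in h6.
  have h7 : `|corr s * cos (t * walk s + th + t * (mart s - walk s))| <= C * 1.
    by rewrite normrM ler_pM// cos_max.
  have q0 : 0 <= t ^+ 2 / 2 by rewrite divr_ge0// sqr_ge0.
  rewrite [X in _ + X]normrM (ger0_norm q0).
  have h8 : t * `|mart s - walk s| <= t * C by rewrite ler_wpM2l.
  have h9 : t ^+ 2 / 2 * `|corr s * cos (t * walk s + th + t * (mart s - walk s))| <=
     t * C.
    rewrite mulr1 in h7; rewrite ler_pM//.
    by have := sqr_ge0 t; lra.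
  by move: h6 h8 h9; lra.
have e3 : `|mean N F - mean N (fun s => cos (t * walk s + th))| <= 4 * C * t.
  rewrite -meanB.
  apply: (le_trans (ler_norm_mean alpha_gt0 beta_gt0 b0_ge0 B0_ge0 b0_gt0 _ _)).
  rewrite -[leRHS](mean_cst alpha_gt0 beta_gt0 B0_ge0 b0_gt0 N).
  by apply: ler_mean => // s _; exact: e2.
have e4 : `|mean 0 F - cos th| <= 4 * C * t.
  rewrite mean0; have := e2 [::]; rewrite [walk _]big_nil mulr0 add0r; exact.
have e5 : `|r ^+ N * mean 0 F - r ^+ N * cos th| <= 4 * C * t.
  rewrite -mulrBr normrM ger0_norm ?exprn_ge0//; apply: le_trans e4.
  by rewrite ler_piMl// exprn_ile1.
rewrite -rN; move: e1 e3 e5; rewrite !ler_norml.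
set a := mean N F; set a' := mean N _; set x := r ^+ N * _; set y := r ^+ N * _.
move=> /andP[? ?] /andP[? ?] /andP[? ?]; apply/andP; split; lra.
Qed.

Lemma cf_limit (th : R) :
  mean N (fun s => cos ((Num.sqrt N%:R)^-1 * walk s + th)) @[N --> \oo] -->
  expR (- (sigma2 / 2)) * cos th.
Proof.
have [K HK] := cf_bound; apply/subr_cvg0.
apply: (@cvg0_le _ _ (fun N => K * (Num.sqrt N%:R)^-1)); last first.
  by rewrite -(mulr0 K); apply: cvgM; [exact: cvg_cst|exact: cvg_invsqrt].
move=> N N0; apply: HK.
  rewrite invr_gt0 sqrtr_gt0 ltr0n N0 /= invf_le1 ?sqrtr_gt0 ?ltr0n//.
  by rewrite -[leLHS]sqrtr1 ler_sqrt ?ler1n// ltr0n.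
by rewrite exprVn sqr_sqrtr ?ler0n// divff// pnatr_eq0 -lt0n.
Qed.

End urn_limits.

(** * Second and fourth moments of the walk *)

Section urn_moments.
Context {R : realType} {k : nat} (alpha beta : R) (b0 B0 : 'I_k -> R).
Context (alpha_gt0 : 0 < alpha) (beta_gt0 : 0 < beta) (beta_lt1 : beta < 1).
Context (b0_ge0 : forall i, 0 <= b0 i) (B0_ge0 : forall i, 0 <= B0 i).
Context (b0_gt0 : 0 < \sum_i b0 i).
Context (v : 'I_k -> R) (v0 : \sum_i b0 i * v i = 0).

Local Notation psi := (path_law alpha beta b0 B0).
Local Notation mean := (path_mean alpha beta b0 B0).
Local Notation mart := (mart alpha beta b0 B0 v).
Local Notation mart_step := (mart_step alpha beta b0 B0 v).
Local Notation walk := (walk v).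

Lemma mean_step_sqr (I : finType) (p d : I -> R) (m D : R) :
  (forall i, 0 <= p i) -> \sum_i p i = 1 -> (forall i, `|d i| <= D) ->
  \sum_i p i * (m + d i) ^+ 2 <= m ^+ 2 + 2 * `|m| * `|\sum_i p i * d i| + D ^+ 2.
Proof.
move=> p0 p1 dD; set S := `|\sum_i p i * d i|.
have -> : \sum_i p i * (m + d i) ^+ 2 =
    m ^+ 2 * (\sum_i p i) + 2 * m * (\sum_i p i * d i) + \sum_i p i * d i ^+ 2.
  by rewrite !mulr_sumr -!big_split /=; apply: eq_bigr => i _; ring.
rewrite p1 mulr1 lerD// ?lerD//.
  by rewrite (le_trans (ler_norm _))// !normrM ger0_norm.
rewrite -[leRHS]mul1r -p1 mulr_suml ler_sum// => i _.
by rewrite ler_wpM2l// -real_normK ?num_real// lerXn2r ?nnegrE// (le_trans _ (dD i)).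
Qed.

(** The term [6 m^2 d^2] and the odd term [4 m d^3] are both absorbed in [8 D^2 m^2]. *)
Lemma mean_step_pow4 (I : finType) (p d : I -> R) (m D : R) :
  (forall i, 0 <= p i) -> \sum_i p i = 1 -> (forall i, `|d i| <= D) ->
  \sum_i p i * (m + d i) ^+ 4 <= m ^+ 4 + 4 * `|m| ^+ 3 * `|\sum_i p i * d i| +
     8 * D ^+ 2 * m ^+ 2 + 3 * D ^+ 4.
Proof.
move=> p0 p1 dD; set S := `|\sum_i p i * d i|.
have pt i : (m + d i) ^+ 4 <= m ^+ 4 + 4 * m ^+ 3 * d i + (8 * D ^+ 2 * m ^+ 2 + 3 * D ^+ 4).
  have d2 : d i ^+ 2 <= D ^+ 2.
    by rewrite -real_normK ?num_real// lerXn2r ?nnegrE// (le_trans _ (dD i)).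
  set x := d i in d2 *.
  have h1 : (m + x) ^+ 4 = m ^+ 4 + 4 * m ^+ 3 * x +
     (6 * m ^+ 2 * x ^+ 2 + 4 * m * x * x ^+ 2 + (x ^+ 2) ^+ 2) by ring.
  have h2 : 4 * m * x <= 2 * (m ^+ 2 + x ^+ 2) by have := sqr_ge0 (m - x); nra.
  have h3 : 4 * m * x * x ^+ 2 <= 2 * (m ^+ 2 + x ^+ 2) * x ^+ 2.
    by rewrite ler_wpM2r// sqr_ge0.
  have h4 : m ^+ 2 * x ^+ 2 <= m ^+ 2 * D ^+ 2 by rewrite ler_wpM2l// sqr_ge0.
  have h5 : (x ^+ 2) ^+ 2 <= (D ^+ 2) ^+ 2 by rewrite lerXn2r ?nnegrE ?sqr_ge0.
  rewrite h1; have -> : D ^+ 4 = (D ^+ 2) ^+ 2 by ring.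
  by nra.
apply: (@le_trans _ _ (\sum_i p i *
    (m ^+ 4 + 4 * m ^+ 3 * d i + (8 * D ^+ 2 * m ^+ 2 + 3 * D ^+ 4)))).
  by apply: ler_sum => i _; rewrite ler_wpM2l.
have -> : \sum_i p i * (m ^+ 4 + 4 * m ^+ 3 * d i + (8 * D ^+ 2 * m ^+ 2 + 3 * D ^+ 4)) =
    (m ^+ 4 + (8 * D ^+ 2 * m ^+ 2 + 3 * D ^+ 4)) * (\sum_i p i) +
    4 * m ^+ 3 * (\sum_i p i * d i).
  by rewrite !mulr_sumr -!big_split /=; apply: eq_bigr => i _; ring.
rewrite p1 mulr1.
have : 4 * m ^+ 3 * (\sum_i p i * d i) <= 4 * `|m| ^+ 3 * S.
  by apply: (le_trans (ler_norm _)); rewrite normrM normrM normrX (ger0_norm (ler0n _ 4)).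
lra.
Qed.

(** The drift contributes [|m| |E d|] and [|m|^3 |E d|], and [|m|] grows at most
    linearly while the drift decays geometrically: so [|m| |E d|] is bounded, and the
    remaining terms sum up as for independent increments. *)
Lemma mart_moments : exists2 K : R, 0 <= K & forall n,
  mean n (fun s => mart s ^+ 2) <= K * n.+1%:R /\
  mean n (fun s => mart s ^+ 4) <= K * n.+1%:R ^+ 2.
Proof.
have [C C0 HC] := step_bounds alpha_gt0 beta_gt0 beta_lt1 B0_ge0 b0_gt0 v0.
have dC s i : `|mart_step s i| <= C by have [_ ? _ _ _] := HC s.
pose M := `|mart [::]| + C.
have M0 : 0 <= M by rewrite addr_ge0.
have mM s : `|mart s| <= M * (size s).+1%:R.
  apply: (le_trans (mart_bound alpha_gt0 beta_lt1 b0_gt0 s dC)).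
  rewrite /M -natr1; have := normr_ge0 (mart [::]); have := ler0n R (size s); nra.
have mE s : `|mart s| * `|\sum_i psi s i * mart_step s i| <= M * C * (1 - beta)^-1.
  have [_ _ _ _ [h _]] := HC s.
  apply: (le_trans (ler_pM _ _ (mM s) h)) => //.
  rewrite [leLHS](_ : _ = M * C * ((size s).+1%:R * beta ^+ size s)); last by ring.
  by rewrite ler_wpM2l ?mulr_ge0//; exact: natr_geo_le.
pose E := M * C * (1 - beta)^-1.
have E0 : 0 <= E by rewrite !mulr_ge0// invr_ge0 subr_ge0 ltW.
pose K1 := mart [::] ^+ 2 + 2 * E + C ^+ 2.
have K10 : 0 <= K1 by rewrite !addr_ge0 ?sqr_ge0// mulr_ge0.
have H2 n : mean n (fun s => mart s ^+ 2) <= K1 * n.+1%:R.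
  elim: n => [|n ih].
    rewrite mean0 mulr1 /K1 -addrA lerDl addr_ge0 ?sqr_ge0// mulr_ge0//.
  rewrite meanS.
  apply: (@le_trans _ _ (mean n (fun s => mart s ^+ 2 + (2 * E + C ^+ 2)))).
    apply: ler_mean => // s sn.
    under eq_bigr do rewrite mart_cons//.
    apply: (le_trans (mean_step_sqr _ _ _ (dC s))); first by move=> i; exact: path_law_ge0.
      exact: path_law_sum1.
    by have := mE s; rewrite -/E; lra.
  rewrite meanD mean_cst// -[n.+2%:R]natr1 mulrDr mulr1 lerD// /K1 -addrA lerDr.
  exact: sqr_ge0.
clearbody K1.
pose K2 := mart [::] ^+ 4 + (4 * E + 8 * C ^+ 2) * K1 + 3 * C ^+ 4.
have C40 : 0 <= C ^+ 4 by rewrite exprn_ge0.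
have m40 : 0 <= mart [::] ^+ 4 by rewrite (exprM _ 2 2) sqr_ge0.
have EC : 0 <= 4 * E + 8 * C ^+ 2 by rewrite addr_ge0// mulr_ge0// sqr_ge0.
have K20 : 0 <= K2 by rewrite !addr_ge0// mulr_ge0.
have H4 n : mean n (fun s => mart s ^+ 4) <= K2 * n.+1%:R ^+ 2.
  elim: n => [|n ih].
    by rewrite mean0 expr1n mulr1 /K2 -addrA lerDl addr_ge0 ?mulr_ge0.
  rewrite meanS.
  apply: (@le_trans _ _ (mean n (fun s => mart s ^+ 4 +
      ((4 * E + 8 * C ^+ 2) * mart s ^+ 2 + 3 * C ^+ 4)))).
    apply: ler_mean => // s sn.
    under eq_bigr do rewrite mart_cons//.
    apply: (le_trans (mean_step_pow4 _ _ _ (dC s))); first by move=> i; exact: path_law_ge0.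
      exact: path_law_sum1.
    have h : `|mart s| ^+ 3 * `|\sum_i psi s i * mart_step s i| <= E * mart s ^+ 2.
      have -> : mart s ^+ 2 = `|mart s| ^+ 2 by rewrite real_normK ?num_real.
      rewrite exprSr -[leLHS]mulrA [leLHS]mulrC ler_wpM2r ?sqr_ge0//.
    by lra.
  rewrite meanD meanD meanZ mean_cst//.
  have h : (4 * E + 8 * C ^+ 2) * mean n (fun s => mart s ^+ 2) <=
     (4 * E + 8 * C ^+ 2) * (K1 * n.+1%:R) by rewrite ler_wpM2l.
  have n1 : 1 <= n.+1%:R :> R by rewrite ler1n.
  rewrite -[n.+2%:R]natr1; set N := n.+1%:R in ih h n1 *.
  have h' : (4 * E + 8 * C ^+ 2) * (K1 * N) + 3 * C ^+ 4 <= K2 * N.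
    rewrite /K2.
    have hh : 3 * C ^+ 4 <= 3 * (C ^+ 4 * N) by rewrite ler_wpM2l// ler_peMr.
    have := mulr_ge0 m40 (le_trans ler01 n1); lra.
  have : 0 <= K2 * N by rewrite mulr_ge0// (le_trans ler01).
  move: ih h h'; set X := mean _ _; set Y := _ * mean _ _; nra.
exists (K1 + K2); first by rewrite addr_ge0.
move=> n; split.
  by apply: (le_trans (H2 n)); rewrite ler_wpM2r// lerDl.
by apply: (le_trans (H4 n)); rewrite ler_wpM2r ?sqr_ge0// lerDr.
Qed.

Lemma walk_moments : exists2 K : R, 0 <= K & forall n,
  mean n (fun s => walk s ^+ 2) <= K * n.+1%:R /\
  mean n (fun s => walk s ^+ 4) <= K * n.+1%:R ^+ 2.
Proof.
have [C C0 HC] := step_bounds alpha_gt0 beta_gt0 beta_lt1 B0_ge0 b0_gt0 v0.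
have [K K0 HK] := mart_moments.
exists (8 * K + 8 * C ^+ 4 + 2 * C ^+ 2).
  by rewrite !addr_ge0 ?mulr_ge0 ?exprn_ge0.
have wm s : walk s ^+ 2 <= 2 * mart s ^+ 2 + 2 * C ^+ 2 /\
    walk s ^+ 4 <= 8 * mart s ^+ 4 + 8 * C ^+ 4.
  have [_ _ _ h _] := HC s.
  have -> : walk s = mart s - mart_coef alpha beta b0 * urn_stat alpha beta B0 v s.
    by rewrite /mart addrK.
  move: h; set x := mart_coef _ _ _ * _; set m := mart s => h.
  have x2 : x ^+ 2 <= C ^+ 2 by rewrite -real_normK ?num_real// lerXn2r ?nnegrE.
  have x4 : (x ^+ 2) ^+ 2 <= (C ^+ 2) ^+ 2 by rewrite lerXn2r ?nnegrE ?sqr_ge0.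
  have h2 y z : (y - z) ^+ 2 <= 2 * y ^+ 2 + 2 * z ^+ 2 :> R.
    by have := sqr_ge0 (y + z); nra.
  split; first by have := h2 m x; lra.
  have -> : C ^+ 4 = (C ^+ 2) ^+ 2 by ring.
  have -> : m ^+ 4 = (m ^+ 2) ^+ 2 by ring.
  have -> : (m - x) ^+ 4 = ((m - x) ^+ 2) ^+ 2 by ring.
  have h3 : ((m - x) ^+ 2) ^+ 2 <= (2 * m ^+ 2 + 2 * x ^+ 2) ^+ 2.
    by rewrite lerXn2r ?nnegrE ?sqr_ge0// addr_ge0// mulr_ge0// sqr_ge0.
  apply: (le_trans h3); have := sqr_ge0 (m ^+ 2 - x ^+ 2).
  by move: x4; move: (m ^+ 2) (x ^+ 2) (C ^+ 2) => a b c; nra.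
move=> n; have [h2 h4] := HK n.
have n1 : 1 <= n.+1%:R :> R by rewrite ler1n.
have n2 : 1 <= n.+1%:R ^+ 2 :> R by rewrite exprn_ege1.
have c4 : 0 <= C ^+ 4 by rewrite exprn_ge0.
have c2 : 0 <= C ^+ 2 by rewrite exprn_ge0.
split.
  apply: (@le_trans _ _ (mean n (fun s => 2 * mart s ^+ 2 + 2 * C ^+ 2))).
    by apply: ler_mean => // s _; have [] := wm s.
  rewrite meanD meanZ mean_cst//; move: h2; set X := mean _ _; set N := n.+1%:R in n1 *.
  nra.
apply: (@le_trans _ _ (mean n (fun s => 8 * mart s ^+ 4 + 8 * C ^+ 4))).
  by apply: ler_mean => // s _; have [] := wm s.
rewrite meanD meanZ mean_cst//; move: h4; set X := mean _ _.
set N := n.+1%:R ^+ 2 in n2 *; nra.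
Qed.

End urn_moments.

(** * The law of the draws *)

Section bridge.
Context {R : realType} {k : nat} {d : measure_display} {Omega : measurableType d}.
Context (P : probability Omega R) (alpha beta : R) (b0 B0 : 'cV[R]_k).
Context (xi : nat -> Omega -> 'cV[R]_k).
Context (urn : rescaled_polya_urn P alpha beta b0 B0 xi).
Context (alpha_gt0 : 0 < alpha) (beta_gt0 : 0 < beta) (beta_lt1 : beta < 1).
Context (c : nat -> Omega -> 'I_k).
Context (cE : forall n w, (1 <= n)%N -> xi n w = delta_mx (c n w) 0).

Local Notation vb0 := (fun i => b0 i 0).
Local Notation vB0 := (fun i => B0 i 0).
Local Notation psi := (path_law alpha beta vb0 vB0).
Local Notation mean := (path_mean alpha beta vb0 vB0).

Fixpoint draws n w : seq 'I_k := if n is m.+1 then c n w :: draws m w else [::].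

Lemma size_draws n w : size (draws n w) = n.
Proof. by elim: n => //= n ->. Qed.

Lemma urn_B_draws n w j : urn_B alpha beta B0 xi n w j 0 = path_content alpha beta vB0 (draws n w) j.
Proof.
elim: n => //= n ih; rewrite mxE [X in X + _]mxE ih; congr (_ + _).
by rewrite mxE cE// mxE eqxx andbT.
Qed.

(** The vectors of the urn are nonnegative, so their norm is linear. *)
Lemma l1norm_sum (x : 'cV[R]_k) : (forall i, 0 <= x i 0) -> l1norm x = \sum_i x i 0.
Proof. by move=> x0; apply: eq_bigr => i _; rewrite ger0_norm. Qed.

Lemma b0_sum_gt0 : 0 < \sum_i b0 i 0.
Proof. by rewrite -l1norm_sum; [exact: urn_b0_gt0 urn|exact: urn_b0_ge0 urn]. Qed.

Lemma urn_psi_draws n w i :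
  urn_psi alpha beta b0 B0 xi n w i 0 = psi (draws n w) i.
Proof.
have N0 j : 0 <= urn_N alpha beta b0 B0 xi n w j 0.
  rewrite mxE urn_B_draws addr_ge0 ?(urn_b0_ge0 urn)//.
  by apply: path_content_ge0 => // i'; exact: urn_B0_ge0 urn i'.
rewrite mxE /path_law l1norm_sum// mulrC; congr (_ / _).
  by rewrite mxE urn_B_draws.
by apply: eq_bigr => j _; rewrite mxE urn_B_draws.
Qed.

Definition cylinder n (s : seq 'I_k) : set Omega := [set w | draws n w = s].

Lemma draw_event n i : (1 <= n)%N ->
  [set w | c n w = i] = [set w | xi n w i 0 = 1].
Proof.
move=> n1; apply/seteqP; split => w /=; rewrite cE// mxE eqxx andbT.
  by move=> ->; rewrite eqxx.
by case: eqVneq => // _ /eqP; rewrite eq_sym oner_eq0.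
Qed.

Lemma draw_event_filtration m n i : (1 <= m <= n)%N ->
  urn_filtration xi n [set w | c m w = i].
Proof.
move=> /andP[m1 mn]; rewrite draw_event//; apply: sub_sigma_algebra.
exists m; first by rewrite /= m1 mn.
exists [set x : 'cV[R]_k | x i 0 = 1]; last by rewrite setTI.
have := @measurable_coord R k i measurableT [set 1]; rewrite setTI; apply.
exact: measurable_set1.
Qed.

Lemma cylinderS n i s :
  cylinder n.+1 (i :: s) = [set w | c n.+1 w = i] `&` cylinder n s.
Proof. by apply/seteqP; split => w /=; [case=> <- <-|case=> <- <-]. Qed.

Lemma cylinder_filtration n m s : (n <= m)%N -> size s = n ->
  urn_filtration xi m (cylinder n s).
Proof.
elim: n s => [|n ih] s nm.
  move=> /size0nil ->; rewrite (_ : cylinder _ _ = setT).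
    exact: (@measurableT _ (g_sigma_algebraType (\bigcup_(m0 in [set m0 | (1 <= m0 <= m)%N])
        preimage_set_system setT (xi m0 : Omega -> borel_cV R k) measurable))).
  by apply/seteqP; split.
case: s => // i s [sn]; rewrite cylinderS.
apply: (@measurableI _ (g_sigma_algebraType (\bigcup_(m0 in [set m0 | (1 <= m0 <= m)%N])
        preimage_set_system setT (xi m0 : Omega -> borel_cV R k) measurable))).
  by apply: draw_event_filtration.
by apply: ih => //; exact: ltnW.
Qed.

Lemma filtration_measurable n (A : set Omega) : urn_filtration xi n A -> measurable A.
Proof.
have sub : (\bigcup_(m in [set m | (1 <= m <= n)%N])
    preimage_set_system setT (xi m : Omega -> borel_cV R k) measurable) `<=`
    (@measurable _ Omega).
  move=> _ [m /= /andP[m1 _] [C mC <-]].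
  exact: (urn_draw_measurable urn m1).
move=> FA; apply: (smallest_sub _ sub FA).
exact: sigma_algebra_measurable.
Qed.

Lemma measurable_cylinder n s : size s = n -> measurable (cylinder n s).
Proof. by move=> sn; apply: (@filtration_measurable n); exact: cylinder_filtration. Qed.

(** The law of the draws is the only place where the conditional probabilities are
    used: on a cylinder of length [n] the vector [psi_n] is constant. *)
Lemma cylinder_prob n s : size s = n ->
  P (cylinder n s) = (path_weight alpha beta vb0 vB0 s)%:E.
Proof.
elim: n s => [|n ih] s.
  move=> /size0nil -> /=; rewrite (_ : cylinder _ _ = setT) ?probability_setT//.
  by apply/seteqP; split.
case: s => // i s [sn]; rewrite cylinderS draw_event//.
have [_ _ /(_ (cylinder n s))] := urn_draw_law urn n i.
move=> -> /=; last by apply: cylinder_filtration.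
have mC := measurable_cylinder sn.
rewrite (eq_integral (cst (psi s i)%:E)); last first.
  by move=> w; rewrite inE => /= <-; rewrite urn_psi_draws.
rewrite [LHS](integral_cst P mC) [RHS]EFinM muleC; congr (_ * _)%E.
exact: ih.
Qed.

Lemma mem_paths n (s : seq 'I_k) : (s \in paths n) = (size s == n).
Proof.
apply/idP/eqP; first exact: size_paths.
elim: n s => [|n ih] s; first by move=> /size0nil ->; rewrite inE.
case: s => // i s [sn] /=; apply/allpairsP; exists (s, i) => /=.
by rewrite mem_enum ih.
Qed.

Lemma uniq_paths n : uniq (paths n : seq (seq 'I_k)).
Proof.
elim: n => //= n ih; apply: allpairs_uniq => //; first exact: enum_uniq.
by move=> [s i] [s' i'] _ _ /= [-> ->].
Qed.

Lemma draws_decomp n (h : seq 'I_k -> R) w :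
  h (draws n w) = \sum_(s <- paths n) h s * \1_(cylinder n s) w.
Proof.
rewrite (bigD1_seq (draws n w)) /=; last 2 first.
- by rewrite mem_paths size_draws.
- exact: uniq_paths.
rewrite indicE mem_set// mulr1 big1 ?addr0// => s sp.
rewrite indicE memNset ?mulr0// => e.
by move: sp; rewrite -e eqxx.
Qed.

Lemma integral_indic_sum (I : eqType) (r : seq I) (a : I -> R) (A : I -> set Omega) :
  (forall i, i \in r -> measurable (A i)) ->
  P.-integrable setT (EFin \o (fun w => \sum_(i <- r) a i * \1_(A i) w)) /\
  (\int[P]_w (\sum_(i <- r) a i * \1_(A i) w)%:E =
   (\sum_(i <- r) a i * fine (P (A i)))%:E)%E.
Proof.
elim: r => [|i r ih] mA.
  split.
    apply: (eq_integrable _ (cst 0%E)) => //; last exact: integrable0.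
    by move=> w _; rewrite /= big_nil.
  rewrite big_nil; apply: integral0_eq => w _; by rewrite big_nil.
have [|ir er] := ih; first by move=> j jr; apply: mA; rewrite inE jr orbT.
have mAi : measurable (A i) by apply: mA; rewrite mem_head.
have ii : P.-integrable setT (EFin \o (fun w => a i * \1_(A i) w)).
  rewrite (_ : _ \o _ = (fun w => (a i)%:E * (\1_(A i) w)%:E)%E)//.
  by apply: integrableZl => //; exact: integrable_indic.
split.
  apply: (eq_integrable _ ((EFin \o (fun w => a i * \1_(A i) w)%R) \+
     (EFin \o (fun w => \sum_(i <- r) a i * \1_(A i) w)%R))%E) => //.
    by move=> w _; rewrite /= big_cons EFinD.
  exact: integrableD.
under eq_integral do rewrite big_cons EFinD.
rewrite integralD// er big_cons EFinD; congr (_ + _)%E.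
under eq_integral do rewrite EFinM.
rewrite integralZl//; last exact: integrable_indic.
rewrite integral_indic// setIT EFinM fineK//.
by rewrite fin_num_measure.
Qed.

Lemma integrable_draws n (h : seq 'I_k -> R) :
  P.-integrable setT (EFin \o (fun w => h (draws n w))).
Proof.
apply: (eq_integrable _ (EFin \o (fun w => \sum_(s <- paths n) h s * \1_(cylinder n s) w))) => //.
  by move=> w _; rewrite /= -draws_decomp.
apply: (integral_indic_sum _ _).1 => s /size_paths sn.
exact: measurable_cylinder.
Qed.

(** A function of the first [n] draws is a finite combination of indicators of
    cylinders. *)
Lemma integral_draws n (h : seq 'I_k -> R) :
  (\int[P]_w (h (draws n w))%:E = (mean n h)%:E)%E.
Proof.
under eq_integral do rewrite draws_decomp.
rewrite (integral_indic_sum _ _).2; last first.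
  by move=> s /size_paths sn; exact: measurable_cylinder.
congr EFin; rewrite /path_mean big_seq [RHS]big_seq; apply: eq_bigr => s /size_paths sn.
by rewrite cylinder_prob//= mulrC.
Qed.

End bridge.

(** * Strong law of large numbers *)

(** By comparison with the telescoping series of [2 / ((i + 1) (i + 2))]. *)
Lemma sum_inv_sqr_le (R : realType) n :
  \sum_(0 <= i < n) (i.+1%:R ^+ 2)^-1 <= 2 - 2 * n.+1%:R^-1 :> R.
Proof.
elim: n => [|n ih]; first by rewrite big_nil invr1; lra.
rewrite big_nat_recr//= (le_trans (lerD ih (lexx _)))//.
have : 1 <= n.+1%:R :> R by rewrite ler1n.
rewrite -[n.+2%:R]natr1; set x := n.+1%:R => x1.
have x0 : 0 < x by exact: lt_le_trans x1.
rewrite -subr_ge0 (_ : _ - _ = (x - 1) / (x ^+ 2 * (x + 1))).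
  by rewrite divr_ge0 ?subr_ge0// mulr_ge0 ?sqr_ge0// addr_ge0// ltW.
by field; rewrite !gt_eqF// addr_gt0.
Qed.

Section summable.
Context {R : realType} {d : measure_display} {Omega : measurableType d}.
Context (P : probability Omega R).

(** The integral of the sum of the series is finite, hence almost surely the series
    converges and its terms tend to 0. *)
Lemma ae_cvg0_of_summable (K : R) (Z : nat -> Omega -> R) :
  (forall n, measurable_fun setT (Z n)) -> (forall n w, 0 <= Z n w) ->
  (forall n, \int[P]_w (Z n w)%:E <= (K * (n.+1%:R ^+ 2)^-1)%:E)%E ->
  {ae P, forall w, Z n w @[n --> \oo] --> 0}.
Proof.
move=> mZ Z0 HZ.
have K0 : 0 <= K.
  have : (0 <= (K * (1%:R ^+ 2)^-1)%:E)%E.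
    by apply: le_trans (HZ 0); apply: integral_ge0 => w _; rewrite lee_fin.
  by rewrite lee_fin expr1n invr1 mulr1.
have mZE n : measurable_fun setT (EFin \o Z n) by exact/measurable_EFinP.
pose S w : \bar R := (\sum_(n <oo) (Z n w)%:E)%E.
have mS : measurable_fun setT S.
  apply: ge0_emeasurable_sum => [n w _ _|n _]; last exact: mZE.
  by rewrite lee_fin.
have SK : (\int[P]_w S w <= (K * 2)%:E)%E.
  rewrite integral_nneseries => [|//|n|n w _]; last 2 first.
  - exact: mZE.
  - by rewrite lee_fin.
  apply: lime_le.
    by apply: is_cvg_nneseries => n _ _; apply: integral_ge0 => w _; rewrite lee_fin.
  apply: nearW => n; apply: (@le_trans _ _ (\sum_(0 <= i < n) (K * (i.+1%:R ^+ 2)^-1)%:E)%E).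
    by apply: lee_sum => i _; exact: HZ.
  rewrite sumEFin lee_fin -mulr_sumr ler_wpM2l//.
  by apply: (le_trans (sum_inv_sqr_le _ _)); rewrite lerBlDr lerDl mulr_ge0.
have S0 w : (0 <= S w)%E by apply: nneseries_ge0 => n _ _; rewrite lee_fin.
have iS : P.-integrable setT S.
  apply/integrableP; split => //.
  rewrite (eq_integral S); first by apply: le_lt_trans SK _; rewrite ltry.
  by move=> w _; rewrite gee0_abs.
have := integrable_ae measurableT iS; apply: filterS => w /(_ I) Sfin.
apply: (@cvg_series_cvg_0 R R^o); apply: nondecreasing_is_cvgn.
  by apply: nondecreasing_series => n _ _; exact: Z0.
exists (fine (S w)) => _ [n _ <-].
rewrite -lee_fin fineK// /series /= -sumEFin.
by apply: nneseries_lim_ge => i _ _; rewrite lee_fin.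
Qed.
End summable.

Section urn_lln.
Context {R : realType} {k : nat} {d : measure_display} {Omega : measurableType d}.
Context (P : probability Omega R) (alpha beta : R) (b0 B0 : 'cV[R]_k).
Context (xi : nat -> Omega -> 'cV[R]_k).
Context (urn : rescaled_polya_urn P alpha beta b0 B0 xi).
Context (alpha_gt0 : 0 < alpha) (beta_gt0 : 0 < beta) (beta_lt1 : beta < 1).
Context (c : nat -> Omega -> 'I_k).
Context (cE : forall n w, (1 <= n)%N -> xi n w = delta_mx (c n w) 0).

Local Notation draws := (draws c).

(** Fourth moments of order [n ^ 2] make the fourth powers of the averages summable,
    so no subsequence is needed. *)
Lemma walk_lln (v : 'I_k -> R) : \sum_i b0 i 0 * v i = 0 ->
  {ae P, forall w, walk v (draws n w) / n%:R @[n --> \oo] --> 0}.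
Proof.
move=> v0.
have b0g := b0_sum_gt0 urn.
have [K K0 HK] := @walk_moments R k alpha beta (fun i => b0 i 0) (fun i => B0 i 0)
  alpha_gt0 beta_gt0 beta_lt1 (urn_b0_ge0 urn) (urn_B0_ge0 urn) b0g v v0.
(* The index is shifted so that no division by zero occurs. *)
pose Z n w := (walk v (draws n.+1 w) / n.+1%:R) ^+ 4.
have ipath n (h : seq 'I_k -> R) := integral_draws urn alpha_gt0 beta_gt0 cE n h.
have : {ae P, forall w, Z n w @[n --> \oo] --> 0}.
  apply: (@ae_cvg0_of_summable _ _ _ P (4 * K)).
  - move=> n; have /integrableP[+ _] := @integrable_draws _ _ _ _ P _ _ _ _ _ urn
      c cE n.+1 (fun s => (walk v s / n.+1%:R) ^+ 4).
    by move=> /measurable_EFinP.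
  - by move=> n w; rewrite /Z (exprM _ 2 2) sqr_ge0.
  - move=> n; rewrite (ipath n.+1 (fun s => (walk v s / n.+1%:R) ^+ 4)) lee_fin.
    rewrite (@eq_mean _ _ _ _ _ _ _ _ (fun s => (n.+1%:R ^- 4) * walk v s ^+ 4)); last first.
      by move=> s _; rewrite exprMn exprVn mulrC.
    rewrite meanZ; have [_ h] := HK n.+1.
    have n0 : 0 < n.+1%:R :> R by rewrite ltr0n.
    apply: (le_trans (ler_wpM2l _ h)); first by rewrite invr_ge0 exprn_ge0.
    rewrite mulrC ler_pdivrMr ?exprn_gt0// -[n.+2%:R]natr1.
    have -> : 4 * K * (n.+1%:R ^+ 2)^-1 * n.+1%:R ^+ 4 = K * (2 * n.+1%:R) ^+ 2.
      by field; exact: lt0r_neq0.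
    have n1 : 1 <= n.+1%:R :> R by rewrite ler1n.
    rewrite ler_wpM2l// lerXn2r// ?nnegrE; [by rewrite addr_ge0|by rewrite mulr_ge0|].
    by move: n1; set x := n.+1%:R; lra.
apply: filterS => w hw; rewrite -cvg_shiftS.
apply/cvgr0Pnorm_lt => e e0.
have e4 : 0 < e ^+ 4 by rewrite exprn_gt0.
move/cvgr0Pnorm_lt : hw => /(_ _ e4); apply: filterS => n.
by rewrite /Z normrX ltr_pXn2r// ?nnegrE ?normr_ge0 ?(ltW e0).
Qed.

(** The increments of the linear form [u]: orthogonal to [b0], as the fluctuation
    analysis requires. *)
Definition centred (u : 'cV[R]_k) (i : 'I_k) : R := u i 0 - dot u (urn_p0 b0).

Lemma dot_p0 (u : 'cV[R]_k) : dot u (urn_p0 b0) = (\sum_i b0 i 0 * u i 0) / \sum_i b0 i 0.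
Proof.
rewrite /dot mulr_suml; apply: eq_bigr => i _.
by rewrite mxE (l1norm_sum (urn_b0_ge0 urn)) mulrCA mulrC (mulrC (u i 0)).
Qed.

Lemma centred0 (u : 'cV[R]_k) : \sum_i b0 i 0 * centred u i = 0.
Proof.
rewrite /centred; under eq_bigr do rewrite mulrBr.
rewrite sumrB -mulr_suml dot_p0 mulrC divfK ?subrr// gt_eqF//.
exact: b0_sum_gt0 urn.
Qed.

Lemma dotD (u x y : 'cV[R]_k) : dot u (x + y) = dot u x + dot u y.
Proof. by rewrite /dot -big_split; apply: eq_bigr => i _; rewrite mxE mulrDr. Qed.

Lemma walk_sum (u : 'cV[R]_k) n w :
  walk (centred u) (draws n w) = dot u (\sum_(1 <= m < n.+1) (xi m w - urn_p0 b0)).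
Proof.
elim: n => [|n ih].
  rewrite /walk big_nil big_geq// /dot big1// => i _.
  by rewrite mxE mulr0.
rewrite [draws _ _]/= /walk big_cons -/(walk _ _) ih.
rewrite [in RHS](@big_nat_recr _ _ _ n.+1 1)//= dotD addrC; congr (_ + _).
rewrite /centred /dot.
under [RHS]eq_bigr do rewrite mxE mulrDr mxE mulrN.
rewrite sumrB cE//; congr (_ - _).
rewrite (bigD1 (c n.+1 w))//= mxE !eqxx mulr1 big1 ?addr0// => i /negbTE ic.
by rewrite mxE ic mulr0.
Qed.

Lemma sum_centre N w : (0 < N)%N ->
  N%:R^-1 *: (\sum_(1 <= n < N.+1) (xi n w - urn_p0 b0)) = empirical_mean xi N w - urn_p0 b0.
Proof.
move=> N0; rewrite sumrB scalerBr; congr (_ - _).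
rewrite sumr_const_nat subn1 /= -[urn_p0 b0 *+ N]scaler_nat scalerA mulVf ?scale1r//.
by rewrite pnatr_eq0 -lt0n.
Qed.

Lemma dot_delta (i : 'I_k) (x : 'cV[R]_k) : dot (delta_mx i 0) x = x i 0.
Proof.
rewrite /dot (bigD1 i)//= mxE !eqxx mul1r big1 ?addr0// => j /negbTE ji.
by rewrite mxE ji mul0r.
Qed.

Lemma dotZ (u x : 'cV[R]_k) a : dot u (a *: x) = a * dot u x.
Proof. by rewrite /dot mulr_sumr; apply: eq_bigr => i _; rewrite mxE mulrCA. Qed.

Theorem urn_lln : {ae P, forall w, empirical_mean xi N w @[N --> \oo] --> urn_p0 b0}.
Proof.
have H (i : 'I_k) := walk_lln (centred0 (delta_mx i 0)).
have : {ae P, forall w, forall i : 'I_k,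
    walk (centred (delta_mx i 0)) (draws n w) / n%:R @[n --> \oo] --> 0}.
  by apply: filter_forall.
apply: filterS => w hw; apply/cvgrPdist_lt => e e0.
have : \forall n \near \oo, forall i : 'I_k,
    `|walk (centred (delta_mx i 0)) (draws n w) / n%:R| < e.
  apply: filter_forall => i.
  by have /cvgr0Pnorm_lt := hw i; apply.
case=> N _ HN; exists N.+1 => // n /= Nn.
have n0 : (0 < n)%N by exact: leq_trans Nn.
rewrite distrC -sum_centre// [X in X < _]mx_normrE.
apply/bigmax_ltP; split => // -[i j] _ /=; rewrite ord1.
have := HN n (ltnW Nn) i; rewrite walk_sum dot_delta mxE mulrC.
exact.
Qed.

End urn_lln.

(** * Trigonometric approximation on boxes *)

Section trig.
Context {R : realType} {k : nat}.
Notation V := 'cV[R]_k.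

Inductive trig : (V -> R) -> Prop :=
| trig_cos u th : trig (fun x => cos (dot u x + th))
| trigD f g : trig f -> trig g -> trig (fun x => f x + g x)
| trigZ a f : trig f -> trig (fun x => a * f x).

Lemma trig_cst a : trig (fun=> a).
Proof.
rewrite (_ : (fun=> a) = (fun x : V => a * cos (dot 0 x + 0))).
  by apply: trigZ; exact: trig_cos.
apply/funext => x; rewrite addr0 /dot big1 ?cos0 ?mulr1// => i _.
by rewrite mxE mul0r.
Qed.

(** The product-to-sum formula. *)
Lemma trigM f g : trig f -> trig g -> trig (fun x => f x * g x).
Proof.
move=> tf; elim: tf g => {f} [u th|f1 f2 _ ih1 _ ih2|a f _ ih] g tg.
- elim: tg => {g} [u' th'|g1 g2 _ ih1 _ ih2|a g _ ih].
  + rewrite (_ : (fun x => _) = (fun x => 2^-1 * (cos (dot (u + u') x + (th + th')) +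
        cos (dot (u - u') x + (th - th'))))).
      by apply: trigZ; apply: trigD; exact: trig_cos.
    apply/funext => x.
    have -> : dot (u + u') x = dot u x + dot u' x.
      by rewrite /dot -big_split; apply: eq_bigr => i _; rewrite mxE mulrDl.
    have -> : dot (u - u') x = dot u x - dot u' x.
      by rewrite /dot -sumrB; apply: eq_bigr => i _; rewrite !mxE mulrBl.
    rewrite (_ : _ + _ + (th + th') = (dot u x + th) + (dot u' x + th')); last by ring.
    rewrite (_ : _ - _ + (th - th') = (dot u x + th) - (dot u' x + th')); last by ring.
    by rewrite (cosB (dot u x + th)) (cosD (dot u x + th)); field.
  + rewrite (_ : (fun x => _) = (fun x => cos (dot u x + th) * g1 x + cos (dot u x + th) * g2 x)).
      exact: trigD.
    by apply/funext => x; rewrite mulrDr.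
  + rewrite (_ : (fun x => _) = (fun x => a * (cos (dot u x + th) * g x))).
      exact: trigZ.
    by apply/funext => x; rewrite mulrCA.
- rewrite (_ : (fun x => _) = (fun x => f1 x * g x + f2 x * g x)).
    by apply: trigD; [exact: ih1|exact: ih2].
  by apply/funext => x; rewrite mulrDl.
- rewrite (_ : (fun x => _) = (fun x => a * (f x * g x))).
    by apply: trigZ; exact: ih.
  by apply/funext => x; rewrite mulrA.
Qed.

Lemma trig_sin_coord (a : R) (i : 'I_k) : trig (fun x => sin (a * x i 0)).
Proof.
rewrite (_ : (fun x => _) = (fun x : V => cos (dot (a *: delta_mx i 0) x + (- (pi / 2))))).
  exact: trig_cos.
apply/funext => x; rewrite cosBpihalf; congr sin.
rewrite /dot (bigD1 i)//= mxE mxE !eqxx mulr1 big1 ?addr0// => j /negbTE ji.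
by rewrite mxE mxE ji mulr0 mul0r.
Qed.

(** The Bernstein operator in several variables, written as the expectation of a
    random walk: the list gives the coordinates to move, and coordinate [i] makes a
    step [1 / m] with probability [t i].  With every coordinate listed [m] times this
    is the usual operator of degree [m], and its moments follow by induction on the
    list. *)
Fixpoint bernstein (m : nat) (t : 'I_k -> R) (l : seq 'I_k) (F : ('I_k -> R) -> R)
    (y : 'I_k -> R) : R :=
  if l is i :: l' then
    (1 - t i) * bernstein m t l' F y +
    t i * bernstein m t l' F (fun j => y j + (j == i)%:R / m%:R)
  else F y.

Lemma bernsteinD m t l F G y :
  bernstein m t l (fun z => F z + G z) y = bernstein m t l F y + bernstein m t l G y.
Proof. by elim: l y => //= i l ih y; rewrite !ih; ring. Qed.

Lemma bernsteinZ m t l a F y : bernstein m t l (fun z => a * F z) y = a * bernstein m t l F y.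
Proof. by elim: l y => //= i l ih y; rewrite !ih; ring. Qed.

Lemma bernstein_cst m t l a y : bernstein m t l (fun=> a) y = a.
Proof. by elim: l y => //= i l ih y; rewrite !ih; ring. Qed.

Lemma bernstein_sum m t l (I : Type) (r : seq I) (F : I -> ('I_k -> R) -> R) y :
  bernstein m t l (fun z => \sum_(i <- r) F i z) y = \sum_(i <- r) bernstein m t l (F i) y.
Proof.
elim: r => [|i r ih].
  by rewrite big_nil; under eq_fun do rewrite big_nil; exact: bernstein_cst.
by rewrite big_cons -ih -bernsteinD; congr bernstein; apply/funext => z; rewrite big_cons.
Qed.

Lemma ler_bernstein m t l F G y : (forall i, 0 <= t i <= 1) -> (forall z, F z <= G z) ->
  bernstein m t l F y <= bernstein m t l G y.
Proof.
move=> t01 FG; elim: l y => //= i l ih y; have /andP[t0 t1] := t01 i.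
by rewrite lerD// ler_wpM2l// subr_ge0.
Qed.

(** Mean and variance of the binomial distribution. *)
Lemma bernstein_sqr m t l (i : 'I_k) a y : (0 < m)%N ->
  bernstein m t l (fun z => (z i - a) ^+ 2) y =
  (y i + (count_mem i l)%:R * t i / m%:R - a) ^+ 2 +
   (count_mem i l)%:R * (t i * (1 - t i)) / m%:R ^+ 2.
Proof.
move=> m0; have mN0 : m%:R != 0 :> R by rewrite pnatr_eq0 -lt0n.
elim: l y => [|j l ih] y /=; first by rewrite !mul0r !addr0.
rewrite !ih natrD eq_sym; case: eqVneq => [->|_] /=; last by rewrite mul0r addr0; ring.
by field.
Qed.

Lemma trig_bernstein m (t : 'I_k -> V -> R) l F y : (forall i, trig (t i)) ->
  trig (fun x => bernstein m (t ^~ x) l F y).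
Proof.
move=> tt; elim: l y => [|i l ih] y /=; first exact: trig_cst.
apply: trigD; apply: trigM => //.
rewrite (_ : (fun x => _) = (fun x => 1 + -1 * t i x)).
  by apply: trigD; [exact: trig_cst|exact: trigZ].
by apply/funext => x; ring.
Qed.

Lemma count_allcoords (m : nat) (i : 'I_k) :
  count_mem i (flatten (nseq m (enum 'I_k))) = m.
Proof.
elim: m => //= m ih; rewrite count_cat ih count_uniq_mem ?enum_uniq//.
by rewrite mem_enum add1n.
Qed.

(** Bernstein's argument: away from [t] the oscillation of [F] is dominated by a
    multiple of the squared distance, whose expectation is at most [k / m]. *)
Lemma bernstein_approx m (t : 'I_k -> R) F (a e K : R) : (0 < m)%N ->
  (forall i, 0 <= t i <= 1) ->
  (forall y, `|F y - a| <= e + K * \sum_i (y i - t i) ^+ 2) -> 0 <= K ->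
  `|bernstein m t (flatten (nseq m (enum 'I_k))) F (fun=> 0) - a| <= e + K * (k%:R / m%:R).
Proof.
move=> m0 t01 Fa K0; set l := flatten _.
have mR : 0 < m%:R :> R by rewrite ltr0n.
pose S (y : 'I_k -> R) := \sum_i (y i - t i) ^+ 2.
have BS : bernstein m t l S (fun=> 0) <= k%:R / m%:R.
  rewrite /S bernstein_sum -[k in k%:R]card_ord -sum1_card natr_sum mulr_suml.
  apply: ler_sum => i _; rewrite bernstein_sqr// count_allcoords add0r.
  have /andP[h0 h1] := t01 i; have mN0 := lt0r_neq0 mR.
  rewrite [leLHS](_ : _ = t i * (1 - t i) / m%:R); last by field.
  rewrite ler_wpM2r// ?invr_ge0 ?ltW//; nra.
have up : bernstein m t l F (fun=> 0) <= a + (e + K * (k%:R / m%:R)).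
  apply: (@le_trans _ _ (bernstein m t l (fun z => (a + e) + K * S z) (fun=> 0))).
    apply: ler_bernstein => // z; have := Fa z; rewrite ler_norml => /andP[_].
    by rewrite -/(S z); lra.
  by rewrite bernsteinD bernstein_cst bernsteinZ -addrA !lerD2l ler_wpM2l.
have lo : a - (e + K * (k%:R / m%:R)) <= bernstein m t l F (fun=> 0).
  apply: (@le_trans _ _ (bernstein m t l (fun z => (a - e) + - K * S z) (fun=> 0))).
    rewrite bernsteinD bernstein_cst bernsteinZ mulNr opprD addrA lerD2l lerN2.
    by rewrite ler_wpM2l.
  apply: ler_bernstein => // z; have := Fa z; rewrite ler_norml => /andP[+ _].
  by rewrite -/(S z); lra.
by rewrite ler_norml; apply/andP; split; lra.
Qed.

Lemma bernstein_bound m t l F y (M : R) : (forall i, 0 <= t i <= 1) ->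
  (forall z, `|F z| <= M) -> `|bernstein m t l F y| <= M.
Proof.
move=> t01 FM; rewrite ler_norml.
rewrite -{1}(bernstein_cst m t l (- M) y) -{2}(bernstein_cst m t l M y).
apply/andP; split; apply: ler_bernstein => // z; have := FM z; rewrite ler_norml.
  by case/andP.
by case/andP.
Qed.

End trig.

Section sin_inverse.
Context {R : realType}.

(** The derivative of the sine is at least 1/2 on this interval. *)
Lemma sin_expand (a b : R) : `|a| <= 2^-1 -> `|b| <= 2^-1 -> a <= b ->
  b - a <= 2 * (sin b - sin a).
Proof.
move=> a2 b2 ab.
have cs : {within `[a, b], continuous (@sin R)}.
  by apply: continuous_subspaceT; exact: continuous_sin.
have [z /[!in_itv]/= /andP[az zb] ->] := MVT_segment ab (fun z _ => is_derive_sin z) cs.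
have z2 : `|z| <= 2^-1.
  by rewrite ler_norml; move: a2 b2; rewrite !ler_norml; lra.
have := cos_sub1_bound z; rewrite ler_norml => /andP[_ h].
have h2 : `|z| ^+ 2 <= 2^-1 by have := normr_ge0 z; nra.
have hc : 2^-1 <= cos z by lra.
have : 0 <= b - a by rewrite subr_ge0.
by move: (cos z) hc => q; nra.
Qed.

(** An inverse of [a |-> (1 + sin a) / 2] on [[-1/2, 1/2]], extended to all arguments by
    clamping; the projection on an interval does not increase the distance to its
    points. *)
Lemma sin_pseudo_inverse : exists h : R -> R, (forall y, `|h y| <= 2^-1) /\
  (forall y a, `|a| <= 2^-1 -> `|h y - a| <= 4 * `|y - (1 + sin a) / 2|).
Proof.
pose s : R := sin 2^-1.
have half : `|2^-1| <= 2^-1 :> R by rewrite ger0_norm.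
have smono a : `|a| <= 2^-1 -> - s <= sin a <= s.
  move=> a2; have /andP[a0 a1] : - 2^-1 <= a <= 2^-1 by rewrite -ler_norml.
  have nh : `|- 2^-1| <= 2^-1 :> R by rewrite normrN.
  have h1 := sin_expand nh a2 a0; have h2 := sin_expand a2 half a1.
  rewrite sinN -/s in h1; rewrite -/s in h2; apply/andP; split; lra.
have s0 : 0 <= s by have := smono 0; rewrite normr0 sin0 => /(_ _)/andP[]//.
have /choice[h hP] : forall y : R, exists b : R, `|b| <= 2^-1 /\
    sin b = Num.max (- s) (Num.min s (2 * y - 1)).
  move=> y; set z := Num.max _ _.
  have cs : {within `[(- 2^-1 : R), 2^-1], continuous (@sin R)}.
    by apply: continuous_subspaceT; exact: continuous_sin.
  have le : - 2^-1 <= 2^-1 :> R by lra.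
  have [|b] := @IVT R sin (- 2^-1) 2^-1 z le cs.
    have zl : - s <= z by rewrite /z le_max lexx.
    have zu : z <= s by rewrite /z ge_max ge_min lexx /= andbT; lra.
    apply/andP; split.
      by rewrite ge_min; apply/orP; left; rewrite sinN.
    by rewrite le_max; apply/orP; right.
  by rewrite in_itv /= -ler_norml => b2 e; exists b.
exists h; split; first by move=> y; have [] := hP y.
move=> y a a2; have [b2] := hP y; set z := Num.max _ _ => e.
have /andP[a0 a1] := smono a a2.
have zb : `|z - sin a| <= 2 * `|y - (1 + sin a) / 2|.
  have -> : 2 * `|y - (1 + sin a) / 2| = `|(2 * y - 1) - sin a|.
    by rewrite -[X in X * _](@ger0_norm R 2)// -normrM; congr (`| _ |); field.
  rewrite /z /Num.max /Num.min; set q := 2 * y - 1.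
  have n1 := ler_norm (q - sin a); have n2 := ler_norm (- (q - sin a)).
  rewrite normrN in n2; have n0 := normr_ge0 (q - sin a).
  by case: (ltP s q) => h1; case: ltP => h2; rewrite ler_norml; apply/andP; split; lra.
apply: (@le_trans _ _ (2 * `|z - sin a|)); last by lra.
rewrite -e; have [ab|ab] := leP a (h y).
  rewrite ger0_norm ?subr_ge0//; apply: (le_trans (sin_expand a2 b2 ab)).
  by rewrite ler_wpM2l// ler_norm.
rewrite distrC gtr0_norm ?subr_gt0//.
apply: (le_trans (sin_expand b2 a2 (ltW ab))).
by rewrite ler_wpM2l// distrC ler_norm.
Qed.

End sin_inverse.

(** * Continuity theorem for characteristic functions *)

Section levy.
Context {R : realType} {k : nat}.
Notation V := 'cV[R]_k.

(** Obtained from the statement for row vectors by transposition. *)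
Lemma compact_box (L : R) : compact [set x : V | forall i, `|x i 0| <= L].
Proof.
rewrite (_ : mkset _ = (trmx : 'rV[R]_k -> V) @`
    [set v : 'rV[R]_k | forall i, `[(- L), L]%classic (v ord0 i)]).
  apply: continuous_compact; last first.
    by apply: (@rV_compact R k (fun=> `[(- L), L]%classic)) => _; exact: segment_compact.
  apply: continuous_subspaceT => x A /nbhs_ballP[e /= e0 eA].
  apply/nbhs_ballP; exists e => //= y [_ xy]; apply: eA; split => // i j.
  by rewrite !mxE.
apply/seteqP; split=> [x /= xL|_ [v /= vL <-] i].
  by exists x^T; rewrite ?trmxK// => i; rewrite mxE /= in_itv /= -ler_norml.
by rewrite mxE; have := vL i; rewrite in_itv /= -ler_norml.
Qed.

Lemma unif_continuous_box (f : V -> R) (L e : R) : continuous f -> 0 < e ->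
  exists2 r : R, 0 < r & forall x y : V, (forall i, `|x i 0| <= L) ->
    (forall i, `|y i 0 - x i 0| < r) -> `|f y - f x| < e.
Proof.
move=> cf e0.
have /compact_near_coveringP nc := @compact_box L.
pose P (r : R) (x : V) := forall y : V, (forall i, `|y i 0 - x i 0| < r) -> `|f y - f x| < e.
have : \forall r \near 0^'+, [set x : V | forall i, `|x i 0| <= L] `<=` P r.
  apply: nc => x _.
  have e2 : 0 < e / 2 by rewrite divr_gt0.
  have /cvgrPdist_lt/(_ _ e2)/nbhs_ballP[r /= r0 rf] := cf x.
  have r2 : 0 < r / 2 by rewrite divr_gt0.
  exists (ball x (r / 2), [set s : R | s < r / 2]).
    by split => /=; [exact: nbhsx_ballx|exact: nbhs_right_lt].
  move=> [x' s] /= [[_ xx'] sr] y yx'.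
  have h1 : `|f x - f x'| < e / 2.
    apply: rf; split => // i j; have := xx' i j.
    by rewrite /ball /= => h; apply: lt_trans h _; lra.
  have h2 : `|f x - f y| < e / 2.
    apply: rf; split => // i j; have := xx' i j; have := yx' i.
    rewrite ord1 /ball /= distrC => a b.
    rewrite (_ : x i 0 - y i 0 = (x i 0 - x' i 0) + (x' i 0 - y i 0)); last by ring.
    apply: (le_lt_trans (ler_normD _ _)); lra.
  rewrite (_ : f y - f x' = (f x - f x') - (f x - f y)); last by ring.
  apply: (le_lt_trans (ler_normB _ _)); lra.
move=> [r /= r0 rP]; exists (r / 2); first by rewrite divr_gt0.
move=> x y xL; apply: (rP (r / 2)) => //=; last by rewrite divr_gt0.
by rewrite sub0r normrN gtr0_norm ?divr_gt0//; lra.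
Qed.

(** In the variables [(1 + sin (x_i / (2 L))) / 2] the Bernstein operator produces a
    trigonometric polynomial.  It is close to [f] on the box, where the change of
    variables is invertible, and bounded by [M] everywhere because the operator is
    positive. *)
Lemma trig_approx (f : V -> R) (M L e : R) : continuous f ->
  (forall x, `|f x| <= M) -> 0 < L -> 0 < e ->
  exists2 g : V -> R, trig g & (forall x : V, `|g x| <= M) /\
    (forall x : V, (forall i, `|x i 0| <= L) -> `|f x - g x| <= e).
Proof.
move=> cf fM L0 e0.
have M0 : 0 <= M by exact: le_trans (fM 0).
have [h [h2 hL]] := @sin_pseudo_inverse R.
have e2 : 0 < e / 2 by rewrite divr_gt0.
have [r r0 fr] := unif_continuous_box L cf e2.
pose F (y : 'I_k -> R) := f (\col_i (2 * L * h (y i))).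
pose t (i : 'I_k) (x : V) := (1 + sin ((2 * L)^-1 * x i 0)) / 2.
have t01 x i : 0 <= t i x <= 1.
  rewrite /t; have := sin_le1 ((2 * L)^-1 * x i 0); have := sin_geN1 ((2 * L)^-1 * x i 0).
  by lra.
(* If some [y i] is at distance at least [r / (8 L)] from [t i x], the trivial bound
   [2 M] on the difference is below [K (y i - t i x)^2]. *)
pose K := 2 * M * (8 * L / r) ^+ 2.
have K0 : 0 <= K by rewrite mulr_ge0 ?sqr_ge0// mulr_ge0.
pose m := (Num.bound (K * k%:R / (e / 2))).+1.
have mR : 0 < m%:R :> R by rewrite ltr0n.
have me : K * (k%:R / m%:R) <= e / 2.
  have : K * k%:R / (e / 2) <= m%:R.
    rewrite (le_trans (ltW (archi_boundP _)))//; last by rewrite /m ler_nat.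
    by apply: divr_ge0; [exact: mulr_ge0|exact: ltW].
  by rewrite ler_pdivrMr// => h3; rewrite mulrA ler_pdivrMr// [leRHS]mulrC.
exists (fun x => bernstein m (t ^~ x) (flatten (nseq m (enum 'I_k))) F (fun=> 0)).
  apply: trig_bernstein => i.
  rewrite (_ : t i = (fun x : V => 2^-1 * (1 + sin ((2 * L)^-1 * x i 0)))).
    by apply: trigZ; apply: trigD; [exact: trig_cst|exact: trig_sin_coord].
  by apply/funext => x; rewrite /t mulrC.
split=> [x|x xL]; first by apply: bernstein_bound => [i|z]; [exact: t01|exact: fM].
rewrite distrC; apply: (@le_trans _ _ (e / 2 + K * (k%:R / m%:R))); last by lra.
apply: bernstein_approx => // y.
have S0 : 0 <= \sum_i (y i - t i x) ^+ 2 by apply: sumr_ge0 => i _; exact: sqr_ge0.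
have [yr|] := pselect (forall i, `|y i - t i x| < r / (8 * L)).
  have : `|F y - f x| < e / 2.
    apply: fr => // i; rewrite mxE.
    have xi2 : `|(2 * L)^-1 * x i 0| <= 2^-1.
      rewrite normrM ger0_norm ?invr_ge0 ?mulr_ge0 ?(ltW L0)// invfM -mulrA.
      rewrite -[leRHS]mulr1 ler_wpM2l// mulrC ler_pdivrMr ?mul1r//.
    have -> : 2 * L * h (y i) - x i 0 = 2 * L * (h (y i) - (2 * L)^-1 * x i 0).
      by field; exact: lt0r_neq0.
    rewrite normrM gtr0_norm ?mulr_gt0//.
    have := hL (y i) _ xi2; rewrite -/(t i x) => hh.
    have yi := yr i; rewrite ltr_pdivlMr ?mulr_gt0// in yi.
    have := ler_wpM2l (ltW L0) hh; move: yi; set a := `|y i - _|; set b := `|h _ - _|; lra.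
  by move=> /ltW hF; rewrite (le_trans hF)// lerDl mulr_ge0.
move=> /existsNP[i /negP]; rewrite -leNgt => yi.
have : `|F y - f x| <= 2 * M.
  rewrite (le_trans (ler_normB _ _))//; have := fM x; have := fM (\col_i (2 * L * h (y i))).
  by rewrite -/(F y); lra.
move/le_trans; apply; apply: (@le_trans _ _ (K * (y i - t i x) ^+ 2)); last first.
  rewrite (bigD1 i)//= mulrDr addrCA lerDl addr_ge0 ?(ltW e2)// mulr_ge0//.
  by apply: sumr_ge0 => j _; exact: sqr_ge0.
have h3 : (r / (8 * L)) ^+ 2 <= (y i - t i x) ^+ 2.
  rewrite -[leRHS]real_normK ?num_real// lerXn2r ?nnegrE// divr_ge0 ?(ltW r0)//.
  by rewrite mulr_ge0// ltW.
apply: le_trans (ler_wpM2l K0 h3); rewrite /K -[leRHS]mulrA -exprMn.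
rewrite (_ : _ * (r / _) = 1) ?expr1n ?mulr1//.
by field; rewrite !lt0r_neq0.
Qed.

Definition bounded_meas (f : V -> R) : Prop :=
  measurable_fun setT (f : borel_cV R k -> R) /\ exists M, forall x, `|f x| <= M.

(** Expectations as normalized positive linear functionals.  Both integrals and the
    finite sums over sequences of draws are of this form, so the continuity theorem
    applies to the latter without transporting them to measures on the space of
    vectors. *)
Definition mean_functional (J : (V -> R) -> R) : Prop :=
  [/\ forall f g, bounded_meas f -> bounded_meas g -> J (fun x => f x + g x) = J f + J g,
      forall a f, bounded_meas f -> J (fun x => a * f x) = a * J f,
      forall f g, bounded_meas f -> bounded_meas g -> (forall x, f x <= g x) -> J f <= J g &
      J (fun=> 1) = 1].

Definition tail (L : R) (x : V) : R := (~~ [forall i, `|x i 0| <= L])%:R.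

(** The bound is required for all larger boxes so that two tight functionals have a
    common box. *)
Definition tight (J : (V -> R) -> R) (e L : R) := forall L', L <= L' -> J (tail L') <= e.

Lemma bounded_meas_continuous f M : continuous f -> (forall x, `|f x| <= M) -> bounded_meas f.
Proof. by move=> cf fM; split; [exact: continuous_measurable_cV|exists M]. Qed.

Lemma bounded_measD f g : bounded_meas f -> bounded_meas g -> bounded_meas (fun x => f x + g x).
Proof.
move=> [mf [M fM]] [mg [M' gM]]; split; first exact: measurable_funD.
by exists (M + M') => x; rewrite (le_trans (ler_normD _ _))// lerD.
Qed.

Lemma bounded_measZ a f : bounded_meas f -> bounded_meas (fun x => a * f x).
Proof.
move=> [mf [M fM]]; split; first by apply: measurable_funM => //; exact: measurable_cst.
by exists (`|a| * M) => x; rewrite normrM ler_wpM2l.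
Qed.

Lemma bounded_meas_cst a : bounded_meas (fun=> a).
Proof. by split; [exact: measurable_cst|exists `|a|]. Qed.

Lemma bounded_meas_trig f : trig f -> bounded_meas f.
Proof.
elim=> {f} [u th|f g _ hf _ hg|a f _ hf]; last 2 first.
- exact: bounded_measD.
- exact: bounded_measZ.
apply: (@bounded_meas_continuous _ 1) => x; last exact: cos_max.
apply: continuous_comp; last exact: continuous_cos.
by apply: continuousD; [exact: continuous_dot|exact: cst_continuous].
Qed.

Lemma bounded_meas_tail L : bounded_meas (tail L).
Proof.
split; last by exists 1 => x; rewrite /tail; case: (~~ _); rewrite ?normr1 ?normr0.
have mB : measurable ([set x : borel_cV R k | forall i, `|(x : V) i 0| <= L]).
  rewrite (_ : mkset _ = \bigcap_(i in [set: 'I_k]) [set x : borel_cV R k | `|(x : V) i 0| <= L]).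
    apply: fin_bigcap_measurable => // i _.
    have := @measurable_fun_ler _ (borel_cV R k) R setT (fun x => `|(x : V) i 0|) (cst L).
    move=> /(_ _ _ measurableT [set true]); rewrite setTI => h.
    rewrite (_ : mkset _ = (fun x : borel_cV R k => `|(x : V) i 0| <= L) @^-1` [set true]).
      by apply: h => //; apply: measurableT_comp => //; exact: measurable_coord.
    by apply/seteqP; split.
  by apply/seteqP; split=> x /= h i; have := h i; [|apply].
rewrite (_ : tail L = \1_(~` [set x : V | forall i, `|x i 0| <= L])).
  by apply: measurable_indic; exact: measurableC.
apply/funext => x; rewrite /tail indicE; congr (nat_of_bool _)%:R.
apply/idP/idP => [/forallP h|]; first by rewrite inE => h'; apply: h.
by rewrite inE => h; apply/forallP.
Qed.

Lemma mean_functionalB J f g : mean_functional J -> bounded_meas f -> bounded_meas g ->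
  J (fun x => f x - g x) = J f - J g.
Proof.
move=> [JD JZ _ _] bf bg; rewrite -mulN1r -JZ// -JD//; last exact: bounded_measZ.
by congr J; apply/funext => x; rewrite mulN1r.
Qed.

(** Off the box the two functions are only known to be bounded by [M]. *)
Lemma mean_close J f g (M e L del : R) : mean_functional J ->
  bounded_meas f -> bounded_meas g ->
  (forall x, `|f x| <= M) -> (forall x, `|g x| <= M) ->
  (forall x : V, (forall i, `|x i 0| <= L) -> `|f x - g x| <= e) -> 0 <= e ->
  J (tail L) <= del -> `|J f - J g| <= e + 2 * M * del.
Proof.
move=> mJ bf bg fM gM fg e0 Jd; rewrite -mean_functionalB//.
have M0 : 0 <= M by exact: le_trans (fM 0).
have [JD JZ Jle J1] := mJ.
have bT : bounded_meas (fun x => e + 2 * M * tail L x).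
  by apply: bounded_measD; [exact: bounded_meas_cst|apply: bounded_measZ; exact: bounded_meas_tail].
have bd : bounded_meas (fun x => f x - g x).
  rewrite (_ : (fun x => _) = (fun x => f x + -1 * g x)); last by apply/funext => x; ring.
  by apply: bounded_measD => //; exact: bounded_measZ.
have JT : J (fun x => e + 2 * M * tail L x) <= e + 2 * M * del.
  rewrite JD; [|exact: bounded_meas_cst|by apply: bounded_measZ; exact: bounded_meas_tail].
  rewrite JZ; last exact: bounded_meas_tail.
  have -> : J (fun=> e) = e.
    rewrite (_ : (fun=> e) = (fun=> e * 1)); last by rewrite mulr1.
    by rewrite JZ ?J1 ?mulr1//; exact: bounded_meas_cst.
  by rewrite lerD2l ler_wpM2l// mulr_ge0.
have pt x : `|f x - g x| <= e + 2 * M * tail L x.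
  rewrite /tail; case: (boolP [forall i, _]) => /= [/forallP h|_].
    by rewrite mulr0 addr0 fg.
  rewrite mulr1 (le_trans (ler_normB _ _))//; have := fM x; have := gM x; lra.
rewrite ler_norml; apply/andP; split.
  rewrite lerNl -mulN1r -JZ//; apply: le_trans JT; apply: Jle => //.
    exact: bounded_measZ.
  by move=> x; rewrite mulN1r; apply: le_trans (pt x); rewrite -normrN ler_norm.
apply: le_trans JT; apply: Jle => // x.
by apply: le_trans (pt x); rewrite ler_norm.
Qed.

Theorem levy_continuity (J_ : nat -> (V -> R) -> R) (J : (V -> R) -> R) :
  (forall n, mean_functional (J_ n)) -> mean_functional J ->
  (forall u th, J_ n (fun x => cos (dot u x + th)) @[n --> \oo] -->
     J (fun x => cos (dot u x + th))) ->
  (forall e, 0 < e -> exists L, (forall n, tight (J_ n) e L) /\ tight J e L) ->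
  forall f M, continuous f -> (forall x, `|f x| <= M) -> J_ n f @[n --> \oo] --> J f.
Proof.
move=> mJ_ mJ Jcos Jtight f M cf fM.
have M0 : 0 <= M by exact: le_trans (fM 0).
have Jtrig g : trig g -> J_ n g @[n --> \oo] --> J g.
  have [JD JZ _ _] := mJ.
  elim=> {g} [u th|f1 f2 t1 h1 t2 h2|a f1 t1 h1]; first exact: Jcos.
    rewrite JD; [|exact: bounded_meas_trig|exact: bounded_meas_trig].
    rewrite (_ : (fun n => _) = (fun n => J_ n f1 + J_ n f2)); first exact: cvgD.
    apply/funext => n; have [JD_ _ _ _] := mJ_ n.
    by apply: JD_; exact: bounded_meas_trig.
  rewrite JZ; last exact: bounded_meas_trig.
  rewrite (_ : (fun n => _) = (fun n => a * J_ n f1)); first by apply: cvgM => //; exact: cvg_cst.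
  apply/funext => n; have [_ JZ_ _ _] := mJ_ n.
  by apply: JZ_; exact: bounded_meas_trig.
apply/cvgrPdist_le => e e0.
have M1 : 0 < 2 * M + 1 by rewrite ltr_wpDl// mulr_ge0.
have del0 : 0 < e / 6 / (2 * M + 1) by rewrite !divr_gt0.
have [L0 [L_ LJ]] := Jtight _ del0.
pose L := Num.max L0 1.
have L1 : 0 < L by rewrite lt_max ltr01 orbT.
have LL : L0 <= L by rewrite le_max lexx.
have e6 : 0 < e / 6 by rewrite divr_gt0.
have [g tg [gM fg]] := trig_approx cf fM L1 e6.
have bf := bounded_meas_continuous cf fM.
have bg := bounded_meas_trig tg.
have small : 2 * M * (e / 6 / (2 * M + 1)) <= e / 6.
  rewrite mulrCA ger_pMr// ler_pdivrMr// mul1r; lra.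
have cJ := mean_close mJ bf bg fM gM fg (ltW e6) (LJ L LL).
have c_ n := mean_close (mJ_ n) bf bg fM gM fg (ltW e6) (L_ n L LL).
have e3 : 0 < e / 3 by rewrite divr_gt0.
have /cvgrPdist_le/(_ _ e3) := Jtrig g tg; apply: filterS => n h.
have := c_ n; rewrite distrC => c'.
rewrite (_ : J f - J_ n f = (J f - J g) + (J g - J_ n g) + (J_ n g - J_ n f)); last by ring.
rewrite (le_trans (ler_normD _ _))// (le_trans (lerD (ler_normD _ _) (lexx _)))//.
by move: cJ h c' small; lra.
Qed.

End levy.

(** * The characteristic function of a real normal law *)

Section gaussian_cf.
Context {R : realType}.
Implicit Types (s u th x : R).
Notation leb := (@lebesgue_measure R).

(** The density is a Radon-Nikodym derivative of the normal law, by uniqueness of the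
    latter. *)
Lemma normal_prob_density s (f : R -> R) :
  (normal_prob 0 s).-integrable setT (EFin \o f) ->
  (\int[normal_prob 0%R s]_x (f x)%:E =
   \int[leb]_x (f x * normal_pdf 0 s x)%:E)%E.
Proof.
move=> intf; set nu := (normal_prob 0 s).
have dom : nu `<< leb by exact: normal_prob_dominates.
rewrite -(Radon_Nikodym_change_of_variables dom measurableT intf).
have mf : measurable_fun setT f by apply/measurable_EFinP; exact: measurable_int intf.
have mpdf : measurable_fun setT (EFin \o normal_pdf 0 s).
  by apply/measurable_EFinP; exact: measurable_normal_pdf.
have mRN : measurable_fun setT (Radon_Nikodym (charge_of_finite_measure nu) leb).
  by apply: measurable_int; exact: Radon_Nikodym_integrable.
transitivity (\int[leb]_x ((EFin \o f) x * (EFin \o normal_pdf 0 s) x))%E; last first.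
  by apply: eq_integral => x _; rewrite /= EFinM.
apply: ae_eq_integral => //.
- by apply: emeasurable_funM => //; exact/measurable_EFinP.
- by apply: emeasurable_funM => //; exact/measurable_EFinP.
apply: ae_eqe_mul2l; apply: integral_ae_eq => //.
  exact: Radon_Nikodym_integrable.
by move=> E _ mE; rewrite -Radon_Nikodym_integral.
Qed.

Lemma continuous_cos_affine u th : continuous (fun x : R => cos (u * x + th)).
Proof.
move=> x; apply: continuous_comp; last exact: continuous_cos.
apply: cvgD; last exact: cvg_cst.
by apply: cvgM; [exact: cvg_cst|exact: cvg_id].
Qed.

Lemma measurable_cos_affine u th : measurable_fun setT (fun x : R => cos (u * x + th)).
Proof. by apply: continuous_measurable_fun; exact: continuous_cos_affine. Qed.

Lemma integrable_normal_cos s u th :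
  (normal_prob 0 s).-integrable setT (EFin \o (fun x : R => cos (u * x + th))).
Proof.
apply: measurable_bounded_integrable => //.
- by rewrite (le_lt_trans (probability_le1 _ _))// ltry.
- exact: measurable_cos_affine.
exists 1; split => // M M1 x _ /=; apply: le_trans (ltW M1).
by rewrite ler_norml cos_le1 cos_geN1.
Qed.

Definition normal_cf_fun s th u : R := \int[leb]_x (cos (u * x + th) * normal_pdf 0 s x).

Lemma normr_le_expR_sqr x : `|x| <= expR (x ^+ 2 / 4).
Proof.
apply: le_trans (expR_ge1Dx _).
rewrite -[x ^+ 2]real_normK ?num_real//; set y := `|x|.
have := sqr_ge0 (y - 2); nra.
Qed.

Lemma normal_pdf_scaleE s x : 0 < s ->
  normal_pdf 0 s x = normal_peak s * expR (- (x ^+ 2) / (s ^+ 2 *+ 2)).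
Proof.
by move=> s0; rewrite normal_pdfE ?gt_eqF// /normal_fun subr0.
Qed.

(** The factor [|x|] is traded for a normal density of larger variance. *)
Lemma norm_normal_pdf_le s x : 0 < s ->
  `|x| * normal_pdf 0 s x <=
  s * normal_peak s / normal_peak (Num.sqrt 2 * s) *
   normal_pdf 0 (Num.sqrt 2 * s) x.
Proof.
move=> s0.
have s20 : 0 < Num.sqrt 2 * s by rewrite mulr_gt0 ?sqrtr_gt0.
rewrite !normal_pdf_scaleE// [leRHS]mulrA divfK ?gt_eqF ?normal_peak_gt0 ?gt_eqF//.
rewrite exprMn sqr_sqrtr//.
have -> : expR (- x ^+ 2 / (2 * s ^+ 2 *+ 2)) =
    expR ((x / s) ^+ 2 / 4) * expR (- x ^+ 2 / (s ^+ 2 *+ 2)).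
  by rewrite -expRD; congr expR; field; exact: lt0r_neq0.
have h : `|x| <= s * expR ((x / s) ^+ 2 / 4).
  have {1}-> : x = s * (x / s) by field; exact: lt0r_neq0.
  by rewrite normrM (gtr0_norm s0) ler_pM2l// normr_le_expR_sqr.
rewrite mulrCA [leRHS](_ : _ = normal_peak s *
  (s * expR ((x / s) ^+ 2 / 4) * expR (- x ^+ 2 / (s ^+ 2 *+ 2)))); last by ring.
by rewrite ler_wpM2l ?normal_peak_ge0// ler_wpM2r ?expR_ge0.
Qed.

Lemma integrable_normal_pdf_bound s (h : R -> R) (C : R) : 0 < s ->
  measurable_fun setT h -> (forall x, `|h x| <= C * (1 + `|x|)) ->
  leb.-integrable setT (EFin \o (fun x => h x * normal_pdf 0 s x)).
Proof.
move=> s0 mh hC.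
have C0 : 0 <= C.
  by have := hC 0; rewrite normr0 addr0 mulr1; apply: le_trans.
set D := s * normal_peak s / normal_peak (Num.sqrt 2 * s).
apply: (@le_integrable _ _ _ leb setT measurableT _
  (EFin \o (fun x => C * (normal_pdf 0 s x + D * normal_pdf 0 (Num.sqrt 2 * s) x)))).
- by apply/measurable_EFinP; apply: measurable_funM => //; exact: measurable_normal_pdf.
- move=> x _ /=; rewrite lee_fin normrM (ger0_norm (normal_pdf_ge0 _ _ _)).
  have := norm_normal_pdf_le x s0; rewrite -/D => h1.
  rewrite [leRHS]ger0_norm; last first.
    rewrite mulr_ge0// addr_ge0 ?normal_pdf_ge0//.
    by apply: le_trans h1; rewrite mulr_ge0 ?normal_pdf_ge0.
  apply: (@le_trans _ _ (C * (1 + `|x|) * normal_pdf 0 s x)).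
    by rewrite ler_wpM2r ?normal_pdf_ge0.
  by rewrite -mulrA ler_wpM2l// mulrDl mul1r lerD2l.
- rewrite (_ : EFin \o _ = (fun x => C%:E *
      ((normal_pdf 0 s x)%:E + D%:E * (normal_pdf 0 (Num.sqrt 2 * s) x)%:E))%E).
    apply: integrableZl => //; apply: integrableD => //.
      exact: integrable_normal_pdf.
    by apply: integrableZl => //; exact: integrable_normal_pdf.
  by apply/funext => x /=; rewrite EFinM EFinD EFinM.
Qed.

Lemma is_derive_cos_affine_u x th u :
  is_derive u 1 (fun u : R => cos (u * x + th)) (- (x * sin (u * x + th))).
Proof.
apply: trigger_derive; rewrite /GRing.scale /=; ring.
Qed.

Lemma is_derive_sin_normal s th u x : 0 < s ->
  is_derive x 1 (fun x : R => sin (u * x + th) * expR (- x ^+ 2 / (s ^+ 2 *+ 2)))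
    ((u * cos (u * x + th) - s ^- 2 * (x * sin (u * x + th))) *
       expR (- x ^+ 2 / (s ^+ 2 *+ 2))).
Proof.
move=> s0; apply: trigger_derive; rewrite /GRing.scale /=.
field; exact: lt0r_neq0.
Qed.

Lemma continuous_sin_affine u th : continuous (fun x : R => sin (u * x + th)).
Proof.
move=> x; apply: continuous_comp; last exact: continuous_sin.
apply: cvgD; last exact: cvg_cst.
by apply: cvgM; [exact: cvg_cst|exact: cvg_id].
Qed.

Lemma measurable_sin_affine u th : measurable_fun setT (fun x : R => sin (u * x + th)).
Proof. by apply: continuous_measurable_fun; exact: continuous_sin_affine. Qed.

Lemma expRN_le_inv (y : R) : 0 < y -> expR (- y) <= y^-1.
Proof.
move=> y0; rewrite expRN lef_pV2 ?posrE ?expR_gt0//.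
by apply: le_trans (expR_ge1Dx _); rewrite lerDr.
Qed.

(** The integrand is the derivative of [sin (u x + th)] times the density, which
    vanishes at infinity. *)
Lemma normal_cf_ibp s u th : 0 < s ->
  \int[leb]_x ((u * cos (u * x + th) - s ^- 2 * (x * sin (u * x + th)))
    * normal_pdf 0 s x) = 0.
Proof.
move=> s0.
set h := (fun x : R => _).
pose H (x : R) := normal_peak s * (sin (u * x + th) * expR (- x ^+ 2 / (s ^+ 2 *+ 2))).
have ih : leb.-integrable setT (EFin \o h).
  apply: (@integrable_normal_pdf_bound s _ (`|u| + s ^- 2)) => //.
    apply: measurable_funB; apply: measurable_funM => //.
      exact: measurable_cos_affine.
    by apply: measurable_funM => //; exact: measurable_sin_affine.
  move=> x; rewrite (le_trans (ler_normB _ _))// !normrM.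
  have := cos_max (u * x + th); have := sin_max (u * x + th).
  have s2 : 0 <= s ^- 2 by rewrite invr_ge0 sqr_ge0.
  rewrite (ger0_norm s2); have := normr_ge0 u; have := normr_ge0 x.
  set c := `|cos _|; set d := `|sin _| => x0 u0 d1 c1.
  have c0 : 0 <= c by exact: normr_ge0.
  have d0 : 0 <= d by exact: normr_ge0.
  rewrite mulrDl lerD//.
    apply: (@le_trans _ _ (`|u| * 1)); first by rewrite ler_wpM2l.
    by rewrite ler_wpM2l// lerDl.
  rewrite ler_wpM2l//; apply: (@le_trans _ _ (`|x| * 1)); first by rewrite ler_wpM2l.
  by rewrite mulr1 lerDr.
have dH x : is_derive x 1 H (h x).
  have := is_derive_sin_normal th u x s0 => hd.
  apply: trigger_derive; rewrite /GRing.scale /= /h normal_pdf_scaleE//.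
  by field; exact: lt0r_neq0.
have ch : continuous h.
  move=> x; rewrite /h; apply: cvgM; last by apply: continuous_normal_pdf; exact: lt0r_neq0.
  apply: cvgB; (apply: cvgM; first exact: cvg_cst).
    exact: continuous_cos_affine.
  by apply: cvgM; [exact: cvg_id|exact: continuous_sin_affine].
have cH : continuous H.
  by move=> x; apply/differentiable_continuous/derivable1_diffP; apply: ex_derive.
pose I n := `[(- n.+1%:R : R), n.+1%:R]%classic.
have ftc n : (\int[leb]_(x in I n) (h x)%:E)%E = (H n.+1%:R - H (- n.+1%:R))%:E.
  rewrite (@continuous_FTC2 _ h H)//.
  - by rewrite -subr_gt0 opprK addr_gt0.
  - exact: continuous_subspaceT.
  - split.
    + by move=> x _; exact: ex_derive.
    + by apply: cvg_at_right_filter; exact: cH.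
    + by apply: cvg_at_left_filter; exact: cH.
  - by move=> x _; rewrite derive1E; exact: derive_val.
have lim1 : (\int[leb]_(x in I n) (h x)%:E)%E @[n --> \oo] --> (\int[leb]_x (h x)%:E)%E.
  under eq_fun do rewrite integral_mkcond.
  apply: (@dominated_cvg _ _ _ leb setT measurableT _ _ (fun x => `|h x|%:E)) => //.
  - move=> n; apply: (measurable_restrictT (EFin \o h) (measurable_itv _)).1.
    by apply: measurable_funTS; exact: measurable_int ih.
  - move=> x _; apply: cvg_near_cst; near=> n.
    rewrite patchE mem_set// /I /= in_itv /= -ler_norml.
    near: n; exists (Num.bound `|x|) => // n /= xn.
    rewrite (le_trans (ltW (archi_boundP (normr_ge0 _))))// ler_nat.
    exact: leqW.
  - by have := integrable_abse ih.
  - move=> n x _; rewrite patchE; case: ifP => _ //=.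
    by rewrite lee_fin normr0 normr_ge0.
have lim2 : (H n.+1%:R - H (- n.+1%:R)) @[n --> \oo] --> 0.
  apply: (@cvg0_le _ _ (fun n : nat => 2 * normal_peak s * (s ^+ 2 *+ 2) * harmonic n)).
  - move=> n _.
    have Hb (x : R) : `|x| = n.+1%:R -> `|H x| <= normal_peak s * ((s ^+ 2 *+ 2) * harmonic n).
      move=> xn; rewrite /H !normrM (ger0_norm (normal_peak_ge0 s)).
      rewrite ler_wpM2l ?normal_peak_ge0// -[leRHS]mul1r ler_pM// ?sin_max//.
      rewrite ger0_norm ?expR_ge0// mulNr.
      have -> : x ^+ 2 = n.+1%:R ^+ 2 by rewrite -xn real_normK ?num_real.
      have s20 : 0 < s ^+ 2 *+ 2 by rewrite pmulrn_lgt0// exprn_gt0.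
      apply: le_trans (expRN_le_inv _) _; first by rewrite divr_gt0// exprn_gt0.
      rewrite invf_div ler_wpM2l ?(ltW s20)// /harmonic /= lef_pV2 ?posrE ?exprn_gt0//.
      by rewrite expr2 ler_peMr// ler1n.
    apply: (le_trans (ler_normB _ _)).
    have h1 := Hb n.+1%:R (ger0_norm (ler0n _ _)).
    have h2 := Hb (- n.+1%:R) (etrans (normrN _) (ger0_norm (ler0n _ _))).
    by apply: le_trans (lerD h1 h2) _; rewrite le_eqVlt; apply/orP; left; apply/eqP; ring.
  - rewrite -[X in _ --> X](mulr0 (2 * normal_peak s * (s ^+ 2 *+ 2))).
    by apply: cvgM; [exact: cvg_cst|exact: cvg_harmonic].
rewrite /Rintegral.
suff -> : (\int[leb]_x (h x)%:E)%E = 0%:E by [].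
apply: (cvg_unique _ lim1) => //.
have -> : (fun n => \int[leb]_(x in I n) (h x)%:E)%E =
    (fun n => (H n.+1%:R - H (- n.+1%:R))%:E) by apply/funext.
by apply: cvg_EFin; [exact: nearW|exact: lim2].
Unshelve. all: by end_near.
Qed.

(** Differentiation under the integral sign, followed by an integration by parts. *)
Lemma is_derive_normal_cf_fun s th u : 0 < s ->
  is_derive u 1 (normal_cf_fun s th) (- (s ^+ 2 * u * normal_cf_fun s th u)).
Proof.
move=> s0.
pose f (u x : R) := cos (u * x + th) * normal_pdf 0 s x.
have df (v x : R) : is_derive v 1 (f ^~ x) (- (x * sin (v * x + th)) * normal_pdf 0 s x).
  have := is_derive_cos_affine_u x th v => hd.
  by apply: trigger_derive; rewrite /GRing.scale /=; ring.
have p1 (v x : R) : partial1of2 f v x = - (x * sin (v * x + th)) * normal_pdf 0 s x.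
  by rewrite /partial1of2 derive1E; exact: derive_val.
have icos v : leb.-integrable setT (EFin \o f v).
  apply: (@integrable_normal_pdf_bound s _ 1) => //.
    exact: measurable_cos_affine.
  by move=> x; rewrite mul1r (le_trans (cos_max _))// lerDl.
have isin v : leb.-integrable setT (EFin \o (fun x => (x * sin (v * x + th)) * normal_pdf 0 s x)).
  apply: (@integrable_normal_pdf_bound s _ 1) => //.
    by apply: measurable_funM => //; exact: measurable_sin_affine.
  move=> x; rewrite mul1r normrM (@le_trans _ _ (`|x| * 1))//.
    by rewrite ler_wpM2l// sin_max.
  by rewrite mulr1 lerDr.
have iabs : leb.-integrable setT (EFin \o (fun x => `|x| * normal_pdf 0 s x)).
  apply: (@integrable_normal_pdf_bound s _ 1) => //.
  by move=> x; rewrite mul1r normr_id lerDr.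
have ui : (`](u - 1), (u + 1)[%classic : set R) u.
  by rewrite /= in_itv /= ltrBlDr ltrDl ltr01.
have G0 (x : R) : 0 <= `|x| * normal_pdf 0 s x.
  by rewrite mulr_ge0 ?normal_pdf_ge0.
have Gb (v x : R) : (`](u - 1), (u + 1)[%classic : set R) v -> setT x ->
    `|partial1of2 f v x| <= `|x| * normal_pdf 0 s x.
  move=> _ _; rewrite p1 normrM (ger0_norm (normal_pdf_ge0 _ _ _)).
  rewrite ler_wpM2r ?normal_pdf_ge0// normrN normrM -[leRHS]mulr1.
  by rewrite ler_wpM2l// sin_max.
have iZ (r : R) (g : R -> R) : leb.-integrable setT (EFin \o g) ->
    leb.-integrable setT (EFin \o (fun x => r * g x)).
  move=> ig; rewrite (_ : _ \o _ = (fun x => r%:E * (EFin \o g) x)%E) //.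
  exact: integrableZl.
have key : \int[leb]_x partial1of2 f u x = - (s ^+ 2 * u * normal_cf_fun s th u).
  have := normal_cf_ibp u th s0.
  rewrite (_ : (fun x => _) = (fun x => u * f u x -
      s ^- 2 * (x * sin (u * x + th) * normal_pdf 0 s x))); last first.
    by apply/funext => x; rewrite /f; ring.
  rewrite RintegralB//; [|exact: iZ|exact: iZ].
  rewrite RintegralZl// RintegralZl// -/(normal_cf_fun s th u).
  have -> : partial1of2 f u = (fun x => -1 * (x * sin (u * x + th) * normal_pdf 0 s x)).
    by apply/funext => x; rewrite p1; ring.
  rewrite RintegralZl//.
  set J := Rintegral _ _ _ => e.
  have -> : J = s ^+ 2 * (u * normal_cf_fun s th u).
    have s2 : s ^+ 2 != 0 by rewrite expf_neq0// gt_eqF.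
    by apply: (mulfI (invr_neq0 s2)); rewrite mulKf//; apply/esym/subr0_eq.
  by ring.
apply: DeriveDef.
  apply: (@derivable_under_integral _ _ _ leb f setT measurableT u
    (u - 1) (u + 1) ui _ _ _ G0 iabs Gb) => //.
rewrite -derive1E -key.
apply: (@differentiation_under_integral _ _ _ leb f setT measurableT u
    (u - 1) (u + 1) ui _ _ _ G0 iabs Gb) => //.
Qed.

(** The differential equation says that [normal_cf_fun s th u * exp (s^2 u^2 / 2)] has
    derivative 0 in [u]. *)
Lemma normal_cf_funE s th u : 0 < s ->
  normal_cf_fun s th u = expR (- (s ^+ 2 * u ^+ 2 / 2)) * cos th.
Proof.
move=> s0.
pose F (v : R) := normal_cf_fun s th v * expR (s ^+ 2 * v ^+ 2 / 2).
have FF : F u = F 0.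
  apply: is_derive_0_is_cst => v.
  have := is_derive_normal_cf_fun th v s0 => hd.
  by apply: trigger_derive; rewrite /GRing.scale /=; field.
have : F 0 = cos th.
  rewrite /F expr0n /= mulr0 mul0r expR0 mulr1 /normal_cf_fun.
  under eq_Rintegral do rewrite mul0r add0r.
  rewrite RintegralZl//; last exact: integrable_normal_pdf.
  by rewrite /Rintegral integral_normal_pdf mulr1.
rewrite -FF /F => <-; rewrite mulrC expRN mulfK// gt_eqF// expR_gt0//.
Qed.

Lemma normal_cf s th u : 0 < s ->
  \int[normal_prob 0 s]_x cos (u * x + th) = expR (- (s ^+ 2 * u ^+ 2 / 2)) * cos th.
Proof.
move=> s0; rewrite -normal_cf_funE// /Rintegral normal_prob_density//.
exact: integrable_normal_cos.
Qed.

End gaussian_cf.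

(** * Laws determined by their characteristic function *)

Section integrals.
Context {R : realType}.

Lemma integrable_bounded d (T : measurableType d) (P : probability T R) (f : T -> R) M :
  measurable_fun setT f -> (forall x, `|f x| <= M) -> P.-integrable setT (EFin \o f).
Proof.
move=> mf fM; apply: measurable_bounded_integrable => //.
  by rewrite (le_lt_trans (probability_le1 _ _))// ltry.
exists M; split; first exact: num_real.
by move=> M' MM' x _ /=; apply: le_trans (ltW MM').
Qed.

Lemma pushforward_prob d d' (T : measurableType d) (T' : measurableType d')
    (P : probability T R) (X : T -> T') : measurable_fun setT X ->
  exists mu : probability T' R, (forall A, mu A = P (X @^-1` A)) /\
    forall (f : T' -> R) M, measurable_fun setT f -> (forall x, `|f x| <= M) ->
      \int[mu]_x f x = \int[P]_x f (X x).
Proof.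
move=> mX; pose Y : {mfun T >-> T'} := mfun_Sub (mem_set mX).
exists (distribution P Y); split=> [A//|f M mf fM].
rewrite /Rintegral integral_distribution//; first exact/measurable_EFinP.
apply: (@integrable_bounded _ _ _ _ M) => //.
exact: measurableT_comp.
Qed.

Lemma integrable_bounded_meas k (mu : probability (borel_cV R k) R) (f : 'cV[R]_k -> R) :
  bounded_meas f -> mu.-integrable setT (EFin \o (f : borel_cV R k -> R)).
Proof. by move=> [mf [M fM]]; exact: (@integrable_bounded _ (borel_cV R k) mu f M). Qed.

Lemma mean_functional_prob k (mu : probability (borel_cV R k) R) :
  mean_functional (fun f : 'cV[R]_k -> R => \int[mu]_x f x).
Proof.
split.
- by move=> f g bf bg; apply: RintegralD => //; exact: integrable_bounded_meas.
- by move=> a f bf; apply: RintegralZl => //; exact: integrable_bounded_meas.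
- by move=> f g bf bg fg; apply: le_Rintegral => //; exact: integrable_bounded_meas.
- by rewrite Rintegral_cst// mul1r [X in fine X](probability_setT mu).
Qed.

Lemma tail_anti k (L L' : R) (x : 'cV[R]_k) : L <= L' -> tail L' x <= tail L x.
Proof.
move=> LL; rewrite /tail; case: (boolP [forall i, `|x i 0| <= L]) => [/forallP h|_] /=.
  rewrite (_ : [forall i, _])//; apply/forallP => i; exact: le_trans (h i) LL.
by case: [forall i, _].
Qed.

(** Dominated convergence, as the boxes exhaust the space. *)
Lemma tight_prob k (mu : probability (borel_cV R k) R) (e : R) : 0 < e ->
  exists L, tight (fun f : 'cV[R]_k -> R => \int[mu]_x f x) e L.
Proof.
move=> e0.
have [_ _ Jle _] := mean_functional_prob mu.
have : (\int[mu]_x (tail n%:R (x : 'cV[R]_k))%:E)%E @[n --> \oo] --> (\int[mu]_x (0:R)%:E)%E.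
  apply: (@dominated_cvg _ _ _ mu setT measurableT _ _ (fun=> 1%E)) => //.
  - by move=> n; apply/measurable_EFinP; have [] := @bounded_meas_tail R k n%:R.
  - move=> x _; apply: cvg_near_cst.
    pose B := \sum_i `|(x : 'cV[R]_k) i 0|.
    exists (Num.bound B) => // n /= nB.
    rewrite /tail (_ : [forall i, _])//; apply/forallP => i.
    apply: (@le_trans _ _ B); first by rewrite /B (bigD1 i)//= lerDl sumr_ge0.
    rewrite (le_trans (ltW (archi_boundP _)))//; first by rewrite sumr_ge0.
    by rewrite ler_nat.
  - by apply: (@integrable_bounded _ _ _ (cst 1) 1) => // x; rewrite normr1.
  - by move=> n x _; rewrite lee_fin /tail; case: (~~ _); rewrite ?normr1 ?normr0.
rewrite integral0_eq// => /fine_cvg /cvgr0Pnorm_le /(_ _ e0)[N _ HN].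
exists N%:R => L NL; apply: (@le_trans _ _ (\int[mu]_x tail N%:R (x : 'cV[R]_k))).
  by apply: Jle => [| |x]; [exact: bounded_meas_tail|exact: bounded_meas_tail|exact: tail_anti].
by apply: le_trans (HN N (leqnn N)); rewrite ler_norm.
Qed.

(** The continuity theorem for a constant sequence. *)
Lemma cf_continuous_eq k (mu nu : probability (borel_cV R k) R) :
  (forall u th, \int[mu]_x cos (dot u (x : 'cV[R]_k) + th) =
     \int[nu]_x cos (dot u (x : 'cV[R]_k) + th)) ->
  forall (f : 'cV[R]_k -> R) M, continuous f -> (forall x, `|f x| <= M) ->
  \int[mu]_x f x = \int[nu]_x f x.
Proof.
move=> cfE f M cf fM.
have H1 u th : (fun=> \int[mu]_x cos (dot u (x : 'cV[R]_k) + th)) n @[n --> \oo] -->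
   \int[nu]_x cos (dot u (x : 'cV[R]_k) + th).
  by rewrite cfE; exact: cvg_cst.
have H2 e : 0 < e -> exists L,
    (forall n : nat, tight (fun f : 'cV[R]_k -> R => \int[mu]_x f x) e L) /\
    tight (fun f : 'cV[R]_k -> R => \int[nu]_x f x) e L.
  move=> e0; have [L1 h1] := tight_prob mu e0; have [L2 h2] := tight_prob nu e0.
  exists (Num.max L1 L2); split=> [_|] L; rewrite ge_max => /andP[? ?].
    exact: h1.
  exact: h2.
have H3 := @levy_continuity R k (fun=> fun f : 'cV[R]_k -> R => \int[mu]_x f x)
  (fun f : 'cV[R]_k -> R => \int[nu]_x f x)
  (fun=> mean_functional_prob mu) (mean_functional_prob nu) H1 H2 f M cf fM.
exact: (cvg_unique _ (@cvg_cst _ _ _ _ _) H3).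
Qed.

Lemma ray_approx (a x : R) :
  (Num.min 1 (Num.max 0 (n%:R * (x - a)))) @[n --> \oo] --> (\1_(`]a, +oo[%classic) x : R).
Proof.
rewrite indicE; have [xa|ax] := leP x a.
  rewrite memNset/=; last by rewrite in_itv /= andbT; apply/negP; rewrite -leNgt.
  apply: cvg_near_cst; apply: nearW => n.
  rewrite max_l ?min_r// mulr_ge0_le0// subr_le0//.
rewrite mem_set/=; last by rewrite in_itv /= andbT.
have xa0 : 0 < x - a by rewrite subr_gt0.
apply: cvg_near_cst; exists (Num.bound (x - a)^-1) => // n /= nB.
have h1 : 1 <= n%:R * (x - a).
  rewrite -ler_pdivrMr// mul1r (le_trans (ltW (archi_boundP _)))//.
    by rewrite invr_ge0 ltW.
  by rewrite ler_nat.
by rewrite max_r ?(le_trans ler01)// min_l.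
Qed.

(** Indicators of open rays are limits of continuous functions with values in
    [[0, 1]], and open rays generate the Borel sets. *)
Lemma measure_eq_of_continuous (mu nu : probability (measurableTypeR R) R) :
  (forall (f : R -> R) M, continuous f -> (forall x, `|f x| <= M) ->
    \int[mu]_x f x = \int[nu]_x f x) ->
  forall A, measurable A -> mu A = nu A.
Proof.
move=> H A mA.
have cover : \bigcup_n `](- n%:R : R), +oo[%classic = [set: R].
  apply/seteqP; split => // x _; exists (Num.bound `|x|) => //=.
  rewrite in_itv /= andbT ltrNl.
  by apply: le_lt_trans (archi_boundP (normr_ge0 x)); rewrite -normrN ler_norm.
have rays a : mu `]a, +oo[%classic = nu `]a, +oo[%classic.
  pose g n (x : R) := Num.min 1 (Num.max 0 (n%:R * (x - a))).
  have cg n : continuous (g n).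
    have cl : continuous (fun x : R => n%:R * (x - a)).
      move=> x; apply: cvgM; first exact: cvg_cst.
      by apply: cvgB; [exact: cvg_id|exact: cvg_cst].
    move=> x.
    have c1 : {for x, continuous (fun x : R => Num.max 0 (n%:R * (x - a)) : R^o)}.
      have := @continuous_max _ _ (cst 0) (fun x : R => n%:R * (x - a) : R^o) x.
      by apply; [exact: cst_continuous|exact: cl].
    have := @continuous_min _ _ (cst 1) (fun x : R => Num.max 0 (n%:R * (x - a)) : R^o) x.
    by apply; [exact: cst_continuous|exact: c1].
  have g1 n x : `|g n x| <= 1.
    by rewrite /g ger0_norm ?ge_min ?lexx// le_min ler01 le_max lexx.
  have L (m : probability (measurableTypeR R) R) :
      (\int[m]_x (g n x)%:E)%E @[n --> \oo] --> m `]a, +oo[%classic.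
    have -> : m `]a, +oo[%classic = (\int[m]_x (\1_(`]a, +oo[%classic) x : R)%:E)%E.
      by rewrite integral_indic// setIT.
    apply: (@dominated_cvg _ _ _ m setT measurableT _ _ (fun=> 1%E)) => //.
    - by move=> n; apply/measurable_EFinP; exact: continuous_measurable_fun.
    - by move=> x _; apply: cvg_EFin; [exact: nearW|exact: ray_approx].
    - by apply: (@integrable_bounded _ _ _ (cst 1) 1) => // x; rewrite normr1.
    - by move=> n x _; rewrite lee_fin.
  have E n : (\int[mu]_x (g n x)%:E = \int[nu]_x (g n x)%:E)%E.
    have mg : measurable_fun setT (g n) by exact: continuous_measurable_fun.
    have fin (m : probability (measurableTypeR R) R) :
        (\int[m]_x (g n x)%:E)%E \is a fin_num.
      by apply: integrable_fin_num => //; exact: (@integrable_bounded _ _ m (g n) 1 mg (g1 n)).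
    rewrite -[LHS]fineK ?fin// -[RHS]fineK ?fin//; congr EFin.
    exact: H (cg n) (g1 n).
  apply: (cvg_unique _ (L mu)) => //.
  rewrite (_ : (fun n => _) = (fun n => \int[nu]_x (g n x)%:E)%E); first exact: L.
  by apply/funext.
apply: (@measure_unique _ R (measurableTypeR R) (@RGenOInfty.G R)
   (fun n => `](- n%:R : R), +oo[%classic) _ _ _ cover mu nu _ _ A mA).
- exact: RGenOInfty.measurableE.
- move=> _ _ [a ->] [b ->]; exists (Num.max a b).
  apply/seteqP; split => x /=; rewrite !in_itv /= !andbT gt_max.
    by move=> [-> ->].
  by case/andP.
- by move=> n; exists (- n%:R).
- by move=> _ [a ->]; exact: rays.
- by move=> n; rewrite (le_lt_trans (probability_le1 _ _))// ?ltry.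
Qed.
End integrals.

(** * Gaussian vectors *)

Section gaussian.
Context {R : realType}.

Lemma measure_eq_of_cf (mu nu : probability (measurableTypeR R) R) :
  (forall u th, \int[mu]_x cos (u * x + th) = \int[nu]_x cos (u * x + th)) ->
  forall A, measurable A -> mu A = nu A.
Proof.
move=> cfE; apply: measure_eq_of_continuous => f M cf fM.
pose X (a : R) : 'cV[R]_1 := const_mx a.
have mX : measurable_fun setT (X : measurableTypeR R -> borel_cV R 1).
  by apply: measurable_cV => i; under eq_fun do rewrite mxE; exact: measurable_id.
have dX u a : dot u (X a) = u 0 0 * a by rewrite /dot big_ord1 mxE.
have [mu' [_ mu'E]] := pushforward_prob mu mX.
have [nu' [_ nu'E]] := pushforward_prob nu mX.
have mcos (u : 'cV[R]_1) th :
    measurable_fun setT (fun x : borel_cV R 1 => cos (dot u (x : 'cV[R]_1) + th)).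
  by have [] := bounded_meas_trig (trig_cos u th).
have cb (u : 'cV[R]_1) th (x : borel_cV R 1) : `|cos (dot u (x : 'cV[R]_1) + th)| <= 1.
  exact: cos_max.
have E := @cf_continuous_eq R 1 mu' nu' _ (fun x : 'cV[R]_1 => f (x 0 0)) M.
have mf : measurable_fun setT (fun x : borel_cV R 1 => f ((x : 'cV[R]_1) 0 0)).
  apply: measurableT_comp; first exact: continuous_measurable_fun.
  exact: measurable_coord.
have := E; rewrite (mu'E _ M mf)// (nu'E _ M mf)//.
rewrite /X; under eq_Rintegral do rewrite mxE; under [X in _ = X]eq_Rintegral do rewrite mxE.
apply => [u th| |x]; last exact: fM.
  rewrite (mu'E _ 1 (mcos u th))// (nu'E _ 1 (mcos u th))//.
  under eq_Rintegral do rewrite dX; under [X in _ = X]eq_Rintegral do rewrite dX.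
  exact: cfE.
move=> x; apply: (@continuous_comp _ _ _ (fun x : 'cV[R]_1 => x 0 0) f).
  exact: coord_continuous.
exact: cf.
Qed.

(** Coordinates are added one at a time, by product measures and Fubini's theorem. *)
Lemma iid_gaussian k : exists mu : probability (borel_cV R k) R, forall u th,
  \int[mu]_x cos (dot u (x : 'cV[R]_k) + th) = expR (- (dot u u / 2)) * cos th.
Proof.
elim: k => [|k [mu muE]].
  have mX : measurable_fun setT ((fun=> 0) : measurableTypeR R -> borel_cV R 0).
    exact: measurable_cst.
  have [mu [_ muE]] := pushforward_prob (normal_prob (0:R) 1) mX.
  exists mu => u th.
  have [mc _] := bounded_meas_trig (trig_cos u th).
  rewrite (muE _ 1 mc) => [|x]; last exact: cos_max.
  rewrite /dot !big_ord0 mul0r oppr0 expR0 mul1r add0r.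
  by rewrite Rintegral_cst// [X in fine X](probability_setT (normal_prob (0:R) 1)) mulr1.
pose P := (normal_prob (0:R) 1 \x mu)%E.
pose X (p : measurableTypeR R * borel_cV R k) : 'cV[R]_(1 + k) :=
  col_mx (const_mx p.1) (p.2 : 'cV[R]_k).
have mX : measurable_fun setT (X : _ -> borel_cV R (1 + k)).
  apply: measurable_cV => i; rewrite /X.
  under eq_fun do rewrite mxE.
  case: (fintype.split i) => j.
    by under eq_fun do rewrite mxE; exact: measurable_fst.
  apply: (measurableT_comp (@measurable_coord R k j)); exact: measurable_snd.
have [mu' [_ mu'E]] := pushforward_prob P mX.
exists mu' => u th.
have [mc _] := bounded_meas_trig (trig_cos u th).
rewrite (mu'E _ 1 mc) => [|x]; last exact: cos_max.
pose u1 := u (lshift k (0 : 'I_1)) 0.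
pose u2 : 'cV[R]_k := \col_j u (rshift 1 j) 0.
have dX p : dot u (X p) = u1 * p.1 + dot u2 p.2.
  transitivity (\sum_(i < 1 + k) u i 0 * X p i 0); first by [].
  rewrite big_split_ord /= big_ord1 /X col_mxEu mxE; congr (_ + _).
  by apply: eq_bigr => i _; rewrite col_mxEd mxE.
have du : dot u u = u1 ^+ 2 + dot u2 u2.
  transitivity (\sum_(i < 1 + k) u i 0 * u i 0); first by [].
  rewrite big_split_ord /= big_ord1; congr (_ + _).
  by apply: eq_bigr => i _; rewrite mxE.
pose f (p : measurableTypeR R * borel_cV R k) : \bar R := (cos (dot u (X p) + th))%:E.
have mf : measurable_fun setT f.
  by apply/measurable_EFinP; apply: (measurableT_comp mc).
have intf : P.-integrable setT f.
  apply: (@integrable_bounded _ _ _ P (fun p => cos (dot u (X p) + th)) 1).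
    exact: (measurableT_comp mc).
  by move=> x; exact: cos_max.
rewrite /Rintegral -/(f _).
have -> : (\int[P]_x (cos (dot u (X x) + th))%:E =
    \int[mu]_y (expR (- (u1 ^+ 2 / 2)) * cos (dot u2 (y : 'cV[R]_k) + th))%:E)%E.
  rewrite -[LHS](integral21_prod_meas1 intf); apply: eq_integral => y _.
  rewrite /fubini_G /f.
  rewrite -[LHS]fineK; last first.
    apply: integrable_fin_num => //.
    apply: (@integrable_bounded _ _ _ _ (fun x => cos (dot u (X (x, y)) + th)) 1).
      under eq_fun do rewrite dX /= -addrA; exact: measurable_cos_affine.
    by move=> x; exact: cos_max.
  congr EFin.
  transitivity (\int[normal_prob 0 1]_x (cos (u1 * x + (dot u2 y + th)))).
    by apply: eq_Rintegral => x _; rewrite dX /= addrA.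
  by rewrite normal_cf// expr1n mul1r.
rewrite -/(Rintegral _ _ _) RintegralZl//; last first.
  exact: (integrable_bounded_meas mu (bounded_meas_trig (trig_cos u2 th))).
rewrite muE du mulrDl opprD expRD; ring.
Qed.

Lemma dot_mulmx k (A : 'M[R]_k) u (x : 'cV[R]_k) : dot u (A *m x) = dot (A^T *m u) x.
Proof. by rewrite -!dotE trmx_mul trmxK mulmxA. Qed.

(** The image by [A] of independent standard normal variables.  The law of a linear
    form is found from its characteristic function; when the variance vanishes this
    is the characteristic function of a Dirac mass. *)
Lemma gaussian_exists k (A : 'M[R]_k) : exists mu : probability (borel_cV R k) R,
  is_gaussian 0 (A *m A^T) mu /\ forall u th,
  \int[mu]_x cos (dot u (x : 'cV[R]_k) + th) =
    expR (- ((u^T *m (A *m A^T) *m u) 0 0 / 2)) * cos th.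
Proof.
have [nu nuE] := iid_gaussian k.
have mA : measurable_fun setT ((fun x : borel_cV R k => A *m (x : 'cV[R]_k)) : _ -> borel_cV R k).
  apply: measurable_cV => i.
  rewrite (_ : (fun x => _) = dot (row i A)^T); first exact: measurable_dot.
  apply/funext => x; rewrite mxE /dot; apply: eq_bigr => j _; by rewrite !mxE.
have [mu [_ muE]] := pushforward_prob nu mA.
have quad (u : 'cV[R]_k) : (u^T *m (A *m A^T) *m u) 0 0 = dot (A^T *m u) (A^T *m u).
  by rewrite -dotE trmx_mul trmxK !mulmxA.
have cf u th : \int[mu]_x cos (dot u (x : 'cV[R]_k) + th) =
    expR (- ((u^T *m (A *m A^T) *m u) 0 0 / 2)) * cos th.
  have [mc _] := bounded_meas_trig (trig_cos u th).
  rewrite (muE _ 1 mc) => [|x]; last exact: cos_max.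
  under eq_Rintegral do rewrite dot_mulmx.
  by rewrite nuE quad.
exists mu; split=> // u B mB.
have mdot : measurable_fun setT (dot u : borel_cV R k -> measurableTypeR R).
  exact: measurable_dot.
have [m1 [m1E m1I]] := pushforward_prob mu mdot.
have -> : mu [set x : 'cV[R]_k | B ((u^T *m x) 0 0)] = m1 B.
  by rewrite m1E; congr (mu _); apply/seteqP; split => x /=; rewrite dotE.
rewrite mulmx0 mxE.
set v := (u^T *m _ *m u) 0 0.
have v0 : 0 <= v.
  by rewrite /v quad /dot sumr_ge0// => i _; rewrite -expr2 sqr_ge0.
have m1cf s th : \int[m1]_x cos (s * x + th) = expR (- (v * s ^+ 2 / 2)) * cos th.
  rewrite (m1I (fun x : R => cos (s * x + th)) 1); last 2 first.
  - exact: measurable_cos_affine.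
  - by move=> x; exact: cos_max.
  transitivity (\int[mu]_x cos (dot (s *: u) (x : 'cV[R]_k) + th)).
    apply: eq_Rintegral => x _; congr (cos (_ + _)).
    by rewrite /dot mulr_sumr; apply: eq_bigr => i _; rewrite mxE mulrA.
  have qs : ((s *: u)^T *m (A *m A^T) *m (s *: u)) 0 0 = v * s ^+ 2.
    rewrite quad -scalemxAr /v quad /dot mulr_suml; apply: eq_bigr => i _.
    by rewrite mxE; ring.
  by rewrite cf qs.
rewrite /normal_law; case: eqVneq => [ve|vn].
  apply: (@measure_eq_of_cf m1 (\d_(0 : measurableTypeR R))) => // s th.
  rewrite m1cf ve mul0r mul0r oppr0 expR0 mul1r.
  rewrite /Rintegral integral_dirac//; last first.
    by apply/measurable_EFinP; exact: measurable_cos_affine.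
  by rewrite [X in (X * _)%E](probability_setT (\d_(0 : measurableTypeR R))) mul1e /= mulr0 add0r.
have sv : 0 < Num.sqrt v by rewrite sqrtr_gt0 lt_neqAle eq_sym vn v0.
apply: (@measure_eq_of_cf m1 (normal_prob 0 (Num.sqrt v))) => // s th.
by rewrite m1cf normal_cf// sqr_sqrtr.
Qed.

End gaussian.

(** * The limit theorem *)

Section assembly.
Context {R : realType} {k : nat} {d : measure_display} {Omega : measurableType d}.
Context (P : probability Omega R) (alpha beta : R) (b0 B0 : 'cV[R]_k).
Context (xi : nat -> Omega -> 'cV[R]_k).
Context (urn : rescaled_polya_urn P alpha beta b0 B0 xi).
Context (alpha_gt0 : 0 < alpha) (beta_gt0 : 0 < beta) (beta_lt1 : beta < 1).

Local Notation p0 := (urn_p0 b0).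
Local Notation vb0 := (fun i => b0 i 0).
Local Notation vB0 := (fun i => B0 i 0).
Local Notation lambda := (urn_lambda alpha beta b0).
Local Notation mean := (path_mean alpha beta vb0 vB0).

Lemma urn_p0E i : p0 i 0 = b0 i 0 / \sum_j b0 j 0.
Proof. by rewrite mxE (l1norm_sum (urn_b0_ge0 urn)) mulrC. Qed.

Lemma urn_p0_ge0 i : 0 <= p0 i 0.
Proof.
rewrite urn_p0E divr_ge0 ?(urn_b0_ge0 urn)//.
exact: ltW (b0_sum_gt0 urn).
Qed.

Lemma urn_p0_sum1 : \sum_i p0 i 0 = 1.
Proof.
under eq_bigr do rewrite urn_p0E.
by rewrite -mulr_suml divff// gt_eqF// (b0_sum_gt0 urn).
Qed.

Lemma urn_gammaE : contraction alpha beta vb0 = urn_gamma alpha beta b0.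
Proof.
have bp := b0_sum_gt0 urn.
rewrite /contraction /urn_gamma (l1norm_sum (urn_b0_ge0 urn)) /inv_total_lim /total_lim.
congr (_ + _).
have h : 0 < 1 - beta by rewrite subr_gt0.
set b := \sum_i _ in bp *.
have h2 : 0 < (1 - beta) * b + alpha by rewrite addr_gt0// mulr_gt0.
have -> : b + alpha / (1 - beta) = ((1 - beta) * b + alpha) / (1 - beta).
  by field; exact: lt0r_neq0.
by rewrite invf_div; ring.
Qed.

Lemma lim_var_lambda v : lim_var alpha beta vb0 v = lambda * color_var vb0 v.
Proof.
rewrite lim_varE//; last exact: b0_sum_gt0 urn.
by rewrite urn_gammaE.
Qed.

(** The quadratic form of the covariance matrix is [lambda] times the variance under
    [p0], which is the limiting variance of the walk. *)
Lemma quad_Sigma2 (u : 'cV[R]_k) :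
  (u^T *m urn_Sigma2 alpha beta b0 *m u) 0 0 =
  lim_var alpha beta vb0 (centred b0 u).
Proof.
rewrite lim_var_lambda /urn_Sigma2 -scalemxAr -scalemxAl mxE; congr (_ * _).
have sv : color_var vb0 (centred b0 u) = \sum_i p0 i 0 * (u i 0 - dot u p0) ^+ 2.
  by rewrite /color_var mulr_suml; apply: eq_bigr => i _; rewrite urn_p0E mulrAC.
rewrite sv (sum_sub_sqr _ _ urn_p0_sum1).
have -> : \sum_i p0 i 0 * u i 0 = dot u p0 by apply: eq_bigr => i _; rewrite mulrC.
rewrite mulmxBr mulmxBl mxE [X in _ + X]mxE.
have -> : (u^T *m diag_mx p0^T *m u) 0 0 = \sum_i p0 i 0 * u i 0 ^+ 2.
  rewrite mxE; apply: eq_bigr => i _.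
  by rewrite mul_mx_diag !mxE; ring.
have -> : (u^T *m (p0 *m p0^T) *m u) 0 0 = dot u p0 ^+ 2.
  rewrite mulmxA -mulmxA mxE big_ord1 dotE dotE expr2; congr (_ * _).
  by apply: eq_bigr => i _; rewrite mulrC.
ring.
Qed.

Lemma lambda_ge0 : 0 <= lambda.
Proof.
have bp := b0_sum_gt0 urn.
have := contraction_gt0 alpha_gt0 beta_gt0 beta_lt1 bp.
have := contraction_lt1 alpha_gt0 beta_lt1 bp.
rewrite urn_gammaE /urn_lambda; set g := urn_gamma _ _ _ => g1 g0.
have g0' := ltW g0; have g1' := ltW g1.
have h : g ^+ 2 <= 1 by rewrite expr_le1.
rewrite mulr_ge0//.
  by rewrite divr_ge0 ?sqr_ge0// addr_ge0 ?sqr_ge0// subr_ge0.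
by rewrite addr_ge0// mulr_ge0// divr_ge0// subr_ge0.
Qed.

Definition urn_root : 'M[R]_k :=
  let q : 'cV[R]_k := \col_i Num.sqrt (p0 i 0) in
  Num.sqrt lambda *: (diag_mx q^T - p0 *m q^T).

(** With [q] the vector of square roots of [p0] and [D = diag q]: [D q = p0] and
    [q^T q = 1], so the two mixed terms and the last one combine to [- p0 p0^T]. *)
Lemma urn_rootE : urn_root *m urn_root^T = urn_Sigma2 alpha beta b0.
Proof.
rewrite /urn_root; set q : 'cV[R]_k := \col_i _.
rewrite linearZ /= -scalemxAl -scalemxAr scalerA -expr2 sqr_sqrtr ?lambda_ge0//.
rewrite /urn_Sigma2; congr (_ *: _).
rewrite linearB /= tr_diag_mx trmx_mul trmxK mulmxBl !mulmxBr.
have qq i : q i 0 * q i 0 = p0 i 0.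
  by rewrite [q i 0]mxE -expr2 sqr_sqrtr ?urn_p0_ge0.
have DD : diag_mx q^T *m diag_mx q^T = diag_mx p0^T.
  apply/matrixP => i j; rewrite mul_diag_mx [LHS]mxE.
  rewrite [diag_mx q^T i j]mxE [RHS]mxE [q^T 0 i]mxE [p0^T 0 i]mxE.
  by case: eqVneq => _; rewrite ?mulr1n ?mulr0n ?mulr0// qq.
have Dq : diag_mx q^T *m q = p0.
  by apply/matrixP => i j; rewrite ord1 mul_diag_mx [LHS]mxE [q^T 0 i]mxE qq.
have qD : q^T *m diag_mx q^T = p0^T.
  by rewrite -[LHS]trmxK trmx_mul tr_diag_mx trmxK Dq.
have q1 : q^T *m q = 1%:M.
  apply/matrixP => i j; rewrite !ord1 [LHS]mxE [RHS]mxE eqxx -[RHS]urn_p0_sum1.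
  by apply: eq_bigr => l _; rewrite [q^T 0 l]mxE qq.
rewrite DD mulmxA Dq -[p0 *m q^T *m diag_mx _]mulmxA qD.
rewrite mulmxA -[p0 *m q^T *m q]mulmxA q1 mulmx1 subrr subr0.
by [].
Qed.

Definition vector_walk (s : seq 'I_k) : 'cV[R]_k := \sum_(i <- s) (delta_mx i 0 - p0).

Lemma dot_vector_walk u s : dot u (vector_walk s) = walk (centred b0 u) s.
Proof.
elim: s => [|i s ih].
  by rewrite /vector_walk /walk !big_nil /dot big1// => i _; rewrite mxE mulr0.
rewrite /vector_walk /walk !big_cons -/(vector_walk _) -/(walk _ _) dotD ih; congr (_ + _).
rewrite dotD -scaleN1r dotZ mulN1r; congr (_ - _).
rewrite /dot (bigD1 i)//= mxE !eqxx mulr1 big1 ?addr0// => j /negbTE ij.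
by rewrite mxE ij mulr0.
Qed.

Definition scaled_mean N (f : 'cV[R]_k -> R) : R :=
  mean N (fun s => f ((Num.sqrt N%:R)^-1 *: vector_walk s)).

Lemma scaled_mean_functional N : mean_functional (scaled_mean N).
Proof.
have bp := b0_sum_gt0 urn.
split.
- by move=> f g _ _; rewrite /scaled_mean meanD.
- by move=> a f _; rewrite /scaled_mean meanZ.
- move=> f g _ _ fg; apply: ler_mean => //; first exact: urn_b0_ge0 urn.
  exact: urn_B0_ge0 urn.
- by rewrite /scaled_mean mean_cst//; exact: urn_B0_ge0 urn.
Qed.

Lemma tail_le L (x : 'cV[R]_k) : 0 < L -> tail L x <= \sum_i (x i 0 / L) ^+ 2.
Proof.
move=> L0; have S0 : 0 <= \sum_i (x i 0 / L) ^+ 2 by rewrite sumr_ge0// => i _; exact: sqr_ge0.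
rewrite /tail; case: (boolP [forall i, _]) => //= /forallPn[i].
rewrite -ltNge => Li; rewrite (bigD1 i)//= -[leLHS]addr0 lerD//; last first.
  by apply: sumr_ge0 => j _; exact: sqr_ge0.
rewrite -real_normK ?num_real// normf_div (gtr0_norm L0) exprn_ege1//.
by rewrite ler_pdivlMr// mul1r ltW.
Qed.

(** Chebyshev's inequality in each coordinate. *)
Lemma scaled_mean_tight e : 0 < e -> exists L, forall N, tight (scaled_mean N) e L.
Proof.
move=> e0; have bp := b0_sum_gt0 urn.
have b0g := urn_b0_ge0 urn; have B0g := urn_B0_ge0 urn.
have /choice[K HK] : forall i : 'I_k, exists K : R, 0 <= K /\ forall n,
    mean n (fun s => walk (centred b0 (delta_mx i 0)) s ^+ 2) <= K * n.+1%:R.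
  move=> i; have [K K0 h] := @walk_moments R k alpha beta vb0 vB0 alpha_gt0 beta_gt0
    beta_lt1 b0g B0g bp _ (centred0 urn (delta_mx i 0)).
  by exists K; split => // n; have [] := h n.
pose C := \sum_i 2 * K i.
have C0 : 0 <= C by apply: sumr_ge0 => i _; rewrite mulr_ge0//; have [] := HK i.
exists (C / e + 1) => N L CL.
have L1 : 1 <= L by apply: le_trans CL; rewrite lerDr divr_ge0// ltW.
have L0 : 0 < L by exact: lt_le_trans L1.
apply: (@le_trans _ _ (C / L ^+ 2)); last first.
  rewrite ler_pdivrMr ?exprn_gt0// -ler_pdivrMl// mulrC.
  apply: (@le_trans _ _ L); first by apply: le_trans CL; rewrite lerDl.
  by rewrite expr2 ler_peMr// ltW.
pose t : R := (Num.sqrt N%:R)^-1.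
apply: (@le_trans _ _ (mean N (fun s => \sum_i (t ^+ 2 / L ^+ 2) *
     walk (centred b0 (delta_mx i 0)) s ^+ 2))).
  apply: ler_mean => // s _; apply: (le_trans (tail_le _ L0)).
  apply: ler_sum => i _; rewrite -dot_vector_walk dot_delta mxE.
  by rewrite expr_div_n exprMn mulrAC.
have mean_sum (I : Type) (r : seq I) (h : I -> seq 'I_k -> R) :
    mean N (fun s => \sum_(i <- r) h i s) = \sum_(i <- r) mean N (h i).
  rewrite /path_mean exchange_big; apply: eq_bigr => s _; by rewrite mulr_sumr.
rewrite mean_sum /C mulr_suml; apply: ler_sum => i _.
rewrite meanZ mulrAC ler_wpM2r ?invr_ge0 ?sqr_ge0//.
have [K0 h] := HK i.
apply: (le_trans (ler_wpM2l (sqr_ge0 _) (h N))).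
rewrite mulrCA mulrC ler_wpM2r// /t exprVn sqr_sqrtr//.
case: (posnP N) => [->|N0]; first by rewrite invr0 mul0r.
rewrite mulrC ler_pdivrMr ?ltr0n// -natr1 mulr_natl mulr2n lerD2l ler1n//.
Qed.

Lemma scaled_mean_cvg (mu : probability (borel_cV R k) R) :
  (forall u th, \int[mu]_x cos (dot u (x : 'cV[R]_k) + th) =
    expR (- ((u^T *m urn_Sigma2 alpha beta b0 *m u) 0 0 / 2)) * cos th) ->
  forall f M, continuous f -> (forall x, `|f x| <= M) ->
  scaled_mean N f @[N --> \oo] --> \int[mu]_x f (x : 'cV[R]_k).
Proof.
move=> cfE; apply: (levy_continuity scaled_mean_functional (mean_functional_prob mu)).
  move=> u th; rewrite cfE quad_Sigma2.
  have := @cf_limit R k alpha beta vb0 vB0 alpha_gt0 beta_gt0 beta_lt1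
    (urn_b0_ge0 urn) (urn_B0_ge0 urn) (b0_sum_gt0 urn) _ (centred0 urn u) th.
  apply: cvg_trans; apply: near_eq_cvg; apply: nearW => N.
  by apply: eq_mean => s _; rewrite dotZ dot_vector_walk.
move=> e e0; have [L1 h1] := scaled_mean_tight e0; have [L2 h2] := tight_prob mu e0.
exists (Num.max L1 L2); split=> [N|] L; rewrite ge_max => /andP[? ?].
  exact: h1.
exact: h2.
Qed.

End assembly.

Theorem theorem3p3 (R : realType) (d : measure_display)
    (Omega : measurableType d) (P : probability Omega R) (k : nat)
    (alpha beta : R) (b0 B0 : 'cV[R]_k) (xi : nat -> Omega -> 'cV[R]_k)
    (k_ge2 : (2 <= k)%N) (alpha_gt0 : 0 < alpha)
    (beta_gt0 : 0 < beta) (beta_lt1 : beta < 1)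
    (urn : rescaled_polya_urn P alpha beta b0 B0 xi) :
  [/\ {ae P, forall w, empirical_mean xi N w @[N --> \oo] --> urn_p0 b0},
      forall (N : nat) (w : Omega), (1 <= N)%N ->
        Num.sqrt N%:R *: (empirical_mean xi N w - urn_p0 b0) =
        (Num.sqrt N%:R)^-1 *: \sum_(1 <= n < N.+1) (xi n w - urn_p0 b0) &
      exists2 mu : probability (borel_cV R k) R,
        is_gaussian 0 (urn_Sigma2 alpha beta b0) mu &
        cvg_in_distribution P
          (fun N w => Num.sqrt N%:R *: (empirical_mean xi N w - urn_p0 b0)) mu].
Proof.
(* The colour of draw 0 is arbitrary. *)
have /choice[c cP] : forall nw : nat * Omega, exists i : 'I_k,
    (1 <= nw.1)%N -> xi nw.1 nw.2 = delta_mx i 0.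
  move=> [[|n] w] /=; first by exists (Ordinal (ltn_trans (ltnSn 0) k_ge2)).
  by have [i ->] := urn_draw_basis urn w (ltn0Sn n); exists i.
pose c' n w := c (n, w).
have cE n w : (1 <= n)%N -> xi n w = delta_mx (c' n w) 0 by exact: (cP (n, w)).
have scale N w : (1 <= N)%N ->
    Num.sqrt N%:R *: (empirical_mean xi N w - urn_p0 b0) =
    (Num.sqrt N%:R)^-1 *: \sum_(1 <= n < N.+1) (xi n w - urn_p0 b0).
  move=> N0; rewrite -sum_centre// scalerA; congr (_ *: _).
  have N1 : 0 < Num.sqrt N%:R :> R by rewrite sqrtr_gt0 ltr0n.
  rewrite -[X in _ / X](@sqr_sqrtr _ N%:R)//.
  by field; exact: lt0r_neq0.
have walkE N w : \sum_(1 <= n < N.+1) (xi n w - urn_p0 b0) = vector_walk b0 (draws c' N w).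
  elim: N => [|N ih]; first by rewrite big_geq// /vector_walk big_nil.
  by rewrite (@big_nat_recr _ _ _ N.+1 1)//= ih /vector_walk big_cons cE// addrC.
split=> //; first exact: (urn_lln urn alpha_gt0 beta_gt0 beta_lt1 cE).
have [mu [mug muE]] := gaussian_exists (urn_root alpha beta b0).
rewrite (urn_rootE urn)// in mug muE.
exists mu => // f cf [M fM].
have := scaled_mean_cvg urn alpha_gt0 beta_gt0 beta_lt1 muE cf fM.
have bf := bounded_meas_continuous cf fM.
have intf := integrable_bounded_meas mu bf.
move=> lim; rewrite -[X in _ --> X]fineK; last exact: integrable_fin_num intf.
rewrite (_ : (fun N => _) = (fun N => (scaled_mean alpha beta b0 B0 N f)%:E)).
  by apply: cvg_EFin; [exact: nearW|exact: lim].
apply/funext => N; rewrite -(integral_draws urn alpha_gt0 beta_gt0 cE).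
apply: eq_integral => w _; congr (f _)%:E.
(* For [N = 0] both arguments of [f] are zero, since [0^-1 = 0]. *)
case: (posnP N) => [->|N0]; last by rewrite scale// walkE.
by rewrite sqrtr0 invr0 !scale0r.
Qed.
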